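(* Suppose that $h$ is a connected, fully commutative permutation whose heap contains at least two entries in each internal column, and let $g$ be the diamond reduction of $h$. If $$G(x)=\sum_{n\ge 0}\bigl|S_{n+1}^{\{[321]\}}(g)\bigr|\,x^n,\qquad G_c(x)=\sum_{n\ge 0}\bigl|\{p\in S_{n+1}^{\{[321]\}}(g): p\text{ is connected}\}\bigr|\,x^n,\qquad F(x)=\sum_{n\ge 0}\bigl|S_{n+1}^{\{[321]\}}(h)\bigr|\,x^n,$$ with $G(0)=1=F(0)$ and $G_c(0)=0$, then the generating functions are rationally related according to $$F(x)=\frac{1-x-xG_c(x)}{1-3x+x^2+(x^2-x)G_c(x)}=\frac{1}{1-2x-x^2G(x)} .$$
   Context: The symmetric group $S_n$ is generated by the adjacent transpositions $s_1,\dots,s_{n-1}$, with $s_i=(i\;\,i+1)$. Reduced expressions for $w$ are words in the $s_i$ of minimal length representing $w$; $\mathrm{supp}(w)$ is the set of generators occurring in any (equivalently every) reduced expression of $w$. A permutation $w\in S_n$ is connected if the subscripts of the generators in $\mathrm{supp}(w)$ form a nonempty interval in $\{1,\dots,n-1\}$. Two reduced expressions of $w$ lie in the same commutativity class if they differ by a sequence of moves $s_is_j\mapsto s_js_i$ with $|i-j|\ge 2$; $w$ is fully commutative if it has exactly one commutativity class. Heaps: for a reduced expression $\mathsf w=\mathsf w_1\cdots\mathsf w_k$, the heap of $\mathsf w$ is the poset on $\{1,\dots,k\}$ given by the transitive closure of: $a\prec b$ if $a<b$ and $\mathsf w_a$ does not commute with $\mathsf w_b$, with element $a$ labeled by $\mathsf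 w_a$. Up to labeled isomorphism it depends only on the commutativity class; a fully commutative permutation has a unique heap. Entries labeled $s_i$ form column $i$. If $w$ is fully commutative and connected with $\mathrm{supp}(w)=\{s_i,s_{i+1},\dots,s_j\}$, then columns $i+1,\dots,j-1$ are the internal columns of the heap of $w$. Diamond reduction: a minimal pair is a pair of entries in the same column of a heap with no other entry of that column between them. In the heap of a fully commutative permutation every minimal pair $x,y$ in column $i$ has a distinct resolution: two entries lying strictly between $x$ and $y$ in the heap, one in column $i-1$ and one in column $i+1$. For $h$ connected and fully commutative with at least two entries in each internal column, every minimal pair together with the entries of its distinct resolution forms a minimal diamond in the heap of $h$. The diamond reduction of $h$ is given by the new heap whose entries correspond to the minimal diamonds, with poset structure inherited from the minimal diamonds in the heap of $h$ by taking the transitive closure of the relation that two minimal diamonds are related if they share an edge (of the Hasse diagram). Pictorially, one adds an entry at the center of each minimal diamond and then erases the heap of $h$; the number of columns decreases by two. For example, the diamond reduction of $s_5s_6s_7s_3s_4s_5s_6s_2s_3s_4s_5s_1s_2s_3$ is $s_4s_5s_2s_3s_4s_1s_2$. Heap containment: an orientation preserving Coxeter embedding $f:\{s_1,\dots,s_{k-1}\}\to\{s_1,\dots,s_{n-1}\}$ is an injective map such that for each $m\in\{2,3\}$, $(s_is_j)^m=1$ if and only if $(f(s_i)f(s_j))^m=1$, and such that the subscript of $f(s_i)$ is less than that of $f(s_j)$ whenever $i<j$; it is applied letterwise to words. A permutation $w\in S_n$ heap-contains $q\in S_k$ if there are commutativity classes of $w$ and $q$, represented by reduced expressions $\mathsf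 w$ and $\mathsf q$, and such an $f$ for which the heap of $f(\mathsf q)$ is contained as a convex labeled subposet of the heap of $\mathsf w$ (a subposet $Q$ of $P$ is convex if $x<y<z$ in $P$ with $x,z\in Q$ implies $y\in Q$). Otherwise $w$ heap-avoids $q$. $S_{n}^{\{[321]\}}(q)$ denotes the set of $w\in S_{n}$ that avoid $[321]$ as a classical permutation pattern (equivalently, are fully commutative) and heap-avoid $q$.
   Formalization: Connected is strengthened for h, and for the p counted by G_c, to mean every generator of the ambient symmetric group is in the support; with arbitrary interval support the formulas fail (for g with at least 3 columns, G_c would have x^2 coefficient 4 instead of 2). *)

(* Defs.v *)
From HB Require Import structures.
From mathcomp Require Import all_boot all_order all_algebra all_fingroup.
From mathcomp Require Import boolp.
From Stdlib Require Import Relations.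

Set Implicit Arguments.
Unset Strict Implicit.
Unset Printing Implicit Defensive.

Import GRing.Theory.

(** * Formal power series over the rationals *)

Section FormalPowerSeries.
Local Open Scope ring_scope.

(* A series is its sequence of coefficients.  The ring structure below is the
   Cauchy product, not the pointwise one of nat -> rat. *)
Definition fps : Type := nat -> rat.

HB.instance Definition _ := gen_eqMixin fps.
HB.instance Definition _ := gen_choiceMixin fps.

Implicit Types s t u : fps.

Definition fps_zero : fps := fun=> 0.
Definition fps_opp s : fps := fun n => - s n.
Definition fps_add s t : fps := fun n => s n + t n.
Definition fps_one : fps := fun n => (n == 0%N)%:R.
Definition fps_mul s t : fps := fun n => \sum_(i < n.+1) s i * t (n - i)%N.

Lemma fps_addA : associative fps_add.
Proof. by move=> s t u; apply/funext=> n; apply: addrA. Qed.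
Lemma fps_addC : commutative fps_add.
Proof. by move=> s t; apply/funext=> n; apply: addrC. Qed.
Lemma fps_add0 : left_id fps_zero fps_add.
Proof. by move=> s; apply/funext=> n; apply: add0r. Qed.
Lemma fps_addN : left_inverse fps_zero fps_opp fps_add.
Proof. by move=> s; apply/funext=> n; apply: addNr. Qed.

HB.instance Definition _ :=
  GRing.isZmodule.Build fps fps_addA fps_addC fps_add0 fps_addN.

Let trunc n s : {poly rat} := \poly_(i < n) s i.

Let fps_mul_trunc n m s t : (n < m)%N ->
  fps_mul s t n = (trunc m s * trunc m t)`_n.
Proof.
move=> lt_nm; rewrite coefM; apply: eq_bigr => i _; rewrite !coef_poly.
rewrite (leq_ltn_trans _ lt_nm) ?(leq_ltn_trans _ lt_nm) ?leq_subr //.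
by rewrite -ltnS.
Qed.

Lemma fps_mulC : commutative fps_mul.
Proof.
by move=> s t; apply/funext=> n; rewrite !(@fps_mul_trunc n n.+1) // mulrC.
Qed.

Lemma fps_mulA : associative fps_mul.
Proof.
move=> s t u; apply/funext=> n.
transitivity (trunc n.+1 s * (trunc n.+1 t * trunc n.+1 u))`_n.
  rewrite coefM; apply: eq_bigr => i _; rewrite coef_poly ltn_ord.
  by rewrite (@fps_mul_trunc _ n.+1) // ltnS leq_subr.
rewrite mulrA coefM; apply: eq_bigr => i _; rewrite coef_poly ltnS leq_subr.
by rewrite (@fps_mul_trunc _ n.+1).
Qed.

Lemma fps_mul1 : left_id fps_one fps_mul.
Proof.
move=> s; apply/funext=> n; rewrite /fps_mul big_ord_recl /fps_one /=.
by rewrite mul1r subn0 big1 ?addr0 // => i _; rewrite mul0r.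
Qed.

Lemma fps_mulDl : left_distributive fps_mul fps_add.
Proof.
move=> s t u; apply/funext=> n; rewrite /fps_add /fps_mul -big_split.
by apply: eq_bigr => i _; rewrite mulrDl.
Qed.

Lemma fps_one_neq0 : fps_one != fps_zero.
Proof. by apply/eqP=> /(congr1 (@^~ 0%N)) /eqP; rewrite oner_eq0. Qed.

HB.instance Definition _ := GRing.Zmodule_isComNzRing.Build fps
  fps_mulA fps_mulC fps_mul1 fps_mulDl fps_one_neq0.

(* The first n coefficients of the inverse of s, when s 0 != 0. *)
Fixpoint fps_inv_coefs s n : seq rat :=
  if n is k.+1 then
    let c := fps_inv_coefs s k in
    rcons c ((s 0%N)^-1 * ((k == 0%N)%:R - \sum_(i < k) c`_i * s (k - i)%N))
  else [::].

Definition fps_unit : {pred fps} := fun s => s 0%N != 0.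

(* As usual for unitRingType, the inverse of a non-unit is itself. *)
Definition fps_inv s : fps :=
  if fps_unit s then fun n => (fps_inv_coefs s n.+1)`_n else s.

Let size_inv_coefs s n : size (fps_inv_coefs s n) = n.
Proof. by elim: n => //= n IHn; rewrite size_rcons IHn. Qed.

Let nth_inv_coefs s n i : (i < n)%N ->
  (fps_inv_coefs s n)`_i = (fps_inv_coefs s i.+1)`_i.
Proof.
elim: n => // n IHn; rewrite ltnS leq_eqVlt => /orP[/eqP-> // | lt_in].
by rewrite {1}[fps_inv_coefs]lock /= -lock /= nth_rcons size_inv_coefs lt_in IHn.
Qed.

Lemma fps_mulV : {in fps_unit, left_inverse 1 fps_inv *%R}.
Proof.
move=> s s_unit; apply/funext=> n; have s0 : s 0%N != 0 by [].
rewrite /fps_inv ifT //; change (1 : fps) with fps_one.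
rewrite {1}/GRing.mul /= /fps_mul big_ord_recr /= subnn.
rewrite nth_rcons size_inv_coefs ltnn eqxx mulrAC mulVf // mul1r.
rewrite addrC [X in _ + X](_ : _ = \sum_(i < n) (fps_inv_coefs s n)`_i * s (n - i)%N).
  by rewrite subrK.
by apply: eq_bigr => i _; rewrite [in RHS]nth_inv_coefs.
Qed.

Lemma fps_unitPl s t : t * s = 1 -> fps_unit s.
Proof.
move/(congr1 (@^~ 0%N)); rewrite {1}/GRing.mul /= /fps_mul big_ord1 subnn.
move=> ts1; apply/eqP=> s0; move/eqP: ts1.
by rewrite s0 mulr0 eq_sym oner_eq0.
Qed.

Lemma fps_inv_out : {in [predC fps_unit], fps_inv =1 id}.
Proof. by move=> s; rewrite inE /fps_inv => /negPf s0; rewrite ifF. Qed.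

HB.instance Definition _ := GRing.ComNzRing_hasMulInverse.Build fps
  fps_mulV fps_unitPl fps_inv_out.

Definition fpsX : fps := fun n => (n == 1%N)%:R.

(* The ordinary generating function of the sequence c. *)
Definition gen_fun (c : nat -> nat) : fps := fun n => (c n)%:R.

End FormalPowerSeries.

(** * Permutations, reduced expressions, full commutativity *)

(* Throughout, elements of 'S_n.+1 permute {0, ..., n} and the generators are
   indexed by 'I_n: gen i exchanges i and i + 1, so it is the classical
   s_(i + 1). *)
Definition gen n (i : 'I_n) : 'S_n.+1 :=
  tperm (widen_ord (leqnSn n) i) (lift ord0 i).

Definition word_prod n (u : seq 'I_n) : 'S_n.+1 := (\prod_(i <- u) gen i)%g.

Definition reduced_expr n (w : 'S_n.+1) (u : seq 'I_n) : Prop :=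
  word_prod u = w /\ forall v, word_prod v = w -> size u <= size v.

Definition in_supp n (w : 'S_n.+1) (i : 'I_n) : Prop :=
  exists2 u, reduced_expr w u & i \in u.

Definition connected n (w : 'S_n.+1) : Prop :=
  exists a b : 'I_n, a <= b /\ forall c : 'I_n, in_supp w c <-> a <= c <= b.

(* Connected permutations are taken in the smallest symmetric group containing
   them.  Both hypotheses of this kind are needed: a coxeter_embedding (below)
   maps all the generators of 'S_k.+1, so the avoidance of q depends on the
   generators missing from its support, and the generating function of the
   connected avoiders is that of the building blocks of all avoiders. *)
Definition full_support n (w : 'S_n.+1) : Prop := forall i, in_supp w i.

Definition comm_move n (u v : seq 'I_n) : Prop :=
  exists (p q : seq 'I_n) (i j : 'I_n),
    [/\ (i.+2 <= j) || (j.+2 <= i),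
        u = p ++ [:: i; j] ++ q & v = p ++ [:: j; i] ++ q].

Definition same_comm_class n : seq 'I_n -> seq 'I_n -> Prop :=
  clos_refl_trans _ (@comm_move n).

Definition fully_commutative n (w : 'S_n.+1) : Prop :=
  exists2 u, reduced_expr w u &
    forall v, reduced_expr w v -> same_comm_class u v.

Definition avoids321 n (w : 'S_n.+1) : Prop :=
  ~ exists i j k : 'I_n.+1, [/\ i < j, j < k, w j < w i & w k < w j].

(** * Heaps *)

(* The entries of the heap of the word u are the positions of u. *)
Notation heap u := 'I_(size u).

Section Heap.
Variables (n : nat) (u : seq 'I_n).
Implicit Types a b x y : heap u.

Definition label a : 'I_n := tnth (in_tuple u) a.

Definition heap_rel : rel (heap u) := fun a b =>
  (a < b) && (gen (label a) * gen (label b) != gen (label b) * gen (label a))%g.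

(* connect is the reflexive transitive closure. *)
Definition heap_lt : rel (heap u) := fun a b => (a != b) && connect heap_rel a b.

(* Edge of the Hasse diagram, from bottom to top. *)
Definition heap_covers : rel (heap u) := fun a b =>
  heap_lt a b && ~~ [exists c, heap_lt a c && heap_lt c b].

Definition minimal_pair x y : bool :=
  [&& label x == label y, heap_lt x y &
      ~~ [exists z, [&& label z == label x, heap_lt x z & heap_lt z y]]].

(* (x, l, r, y): bottom, left, right and top entries. *)
Definition quad : finType := (heap u * heap u * heap u * heap u)%type.

Definition bottom (d : quad) : heap u := d.1.1.1.
Definition left_entry (d : quad) : heap u := d.1.1.2.
Definition right_entry (d : quad) : heap u := d.1.2.
Definition top (d : quad) : heap u := d.2.

Definition entries (d : quad) : {set heap u} :=
  [set bottom d; left_entry d; right_entry d; top d].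

Definition minimal_diamond (d : quad) : bool :=
  [&& minimal_pair (bottom d) (top d),
      (label (left_entry d)).+1 == label (bottom d) :> nat,
      label (right_entry d) == (label (bottom d)).+1 :> nat,
      heap_lt (bottom d) (left_entry d) && heap_lt (left_entry d) (top d)
    & heap_lt (bottom d) (right_entry d) && heap_lt (right_entry d) (top d)].

Definition share_edge (d d' : quad) : bool :=
  [exists a in entries d :&: entries d', exists b in entries d :&: entries d',
     heap_covers a b].

(* Diamonds sharing an edge lie in adjacent columns; the orientation of the
   relation is inherited from the heap by comparing bottom entries. *)
Definition diamond_rel : rel quad := fun d d' =>
  [&& minimal_diamond d, minimal_diamond d', share_edge d d'
    & heap_lt (bottom d) (bottom d')].

Definition diamond_lt : rel quad := fun d d' =>
  (d != d') && connect diamond_rel d d'.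

End Heap.

(* When w is connected, the columns c strictly between two columns of the
   support are the internal ones. *)
Definition two_per_internal_column n (w : 'S_n.+1) : Prop :=
  forall u, reduced_expr w u ->
  forall a b c : 'I_n, in_supp w a -> in_supp w b -> a < c < b ->
    2 <= #|[set x : heap u | label x == c]|.

(* The heap of g is the poset of minimal diamonds of the heap of h.  A diamond
   centered in column i + 1 of the heap of h gives an entry in column i of the
   heap of g: the two outer columns disappear, hence the two sizes. *)
Definition diamond_reduction m (h : 'S_m.+3) (g : 'S_m.+1) : Prop :=
  exists (u : seq 'I_m.+2) (v : seq 'I_m) (phi : heap v -> quad u),
    [/\ reduced_expr h u /\ reduced_expr g v,
        injective phi,
        forall d, minimal_diamond d <-> exists a, d = phi a,
        forall a, label (bottom (phi a)) = (label a).+1 :> nat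
      & forall a b, heap_lt a b = diamond_lt (phi a) (phi b)].

(** * Heap containment *)

Definition coxeter_embedding k n (f : 'I_k -> 'I_n) : Prop :=
  [/\ injective f,
      forall m, m \in [:: 2; 3] -> forall i j,
        ((gen i * gen j) ^+ m = 1 <-> (gen (f i) * gen (f j)) ^+ m = 1)%g
    & forall i j : 'I_k, i < j -> f i < f j].

Definition convex_labeled_subposet n (v u : seq 'I_n) : Prop :=
  exists phi : heap v -> heap u,
    [/\ injective phi,
        forall a, label (phi a) = label a,
        forall a b, heap_lt (phi a) (phi b) = heap_lt a b
      & forall a b y, heap_lt (phi a) y -> heap_lt y (phi b) ->
          exists c, y = phi c].

Definition heap_contains n k (w : 'S_n.+1) (q : 'S_k.+1) : Prop :=
  exists (u : seq 'I_n) (v : seq 'I_k) (f : 'I_k -> 'I_n),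
    [/\ reduced_expr w u, reduced_expr q v, coxeter_embedding f
      & convex_labeled_subposet (map f v) u].

(** * Counting *)

Definition avoiders k (q : 'S_k.+1) n : {set 'S_n.+1} :=
  [set w | `[< avoids321 w /\ ~ heap_contains w q >]].

(* If the support could be any nonempty interval, there would be four connected
   elements in 'S_3 instead of two (for q large), and the two closed forms for
   the generating function would disagree. *)
Definition connected_avoiders k (q : 'S_k.+1) n : {set 'S_n.+1} :=
  [set w in avoiders q n | `[< connected w /\ full_support w >]].

(* Main.v *)
(* The heap of a 321-avoiding permutation w is a skew shape. Call x an exceedance
   if x <= w x. The exceedances never cross each other, nor do the other points,
   so that an entry of the heap is the crossing of an exceedance x with a
   non-exceedance y > x; it lies in the column given by the number k of
   exceedances before x plus the number l of non-exceedances before y, and the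
   heap order is (k, l) <= (k', l') iff k' <= k and l <= l'. The column j
   consists of the k between two boundaries, which count the positions y <= j
   with w^-1 y <= y and the positions x <= j with x <= w x. The pair of
   boundaries is a Motzkin path with two colors of level steps above height 0,
   and every such path comes from a 321-avoiding permutation.

   A convex copy of a connected heap in such a heap is a translate of the
   corresponding pair of boundaries, and diamond reduction raises the lower
   boundary by 1. Hence w contains h iff the region of w with its lower boundary
   raised contains g. Cutting the paths at their returns to height 0 gives
     a = 1 + x a + x^2 c a,  A = 1 + 2 x A + x^2 c A,  f = 1 + x f + x^2 A f,
   where a = 1 + x G, f = 1 + x F, Gc = x c, and A counts the paths avoiding g
   with two colors of level steps at height 0 too: raising the lower boundary of
   an excursion above height 0 produces such a path. *)
Require Import Defs.
From mathcomp Require Import all_boot all_order all_algebra all_fingroup.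
From mathcomp Require Import boolp.
From mathcomp Require Import zify ring.

Set Implicit Arguments.
Unset Strict Implicit.
Unset Printing Implicit Defensive.

Import GRing.Theory.

(** * Adjacent transpositions *)

Lemma gen_val n (i : 'I_n) (p : 'I_n.+1) :
  gen i p = (if p == i :> nat then i.+1 else if p == i.+1 :> nat then i : nat else p)
  :> nat.
Proof.
rewrite /gen permE /= -!val_eqE /= /bump /= add1n.
by do 2!case: ifP => // _; rewrite /= /bump.
Qed.

Lemma genK n (i : 'I_n) : (gen i * gen i = 1)%g.
Proof. exact: tperm2. Qed.

Lemma genV n (i : 'I_n) : ((gen i)^-1 = gen i)%g.
Proof. exact: tpermV. Qed.

Lemma gen_inj n : injective (@gen n).
Proof.
move=> i j /(congr1 (fun s : 'S_n.+1 => val (s (widen_ord (leqnSn n) i)))).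
rewrite /= !gen_val /= eqxx => e; apply/val_inj => /=; move: e.
by case: ifP => [/eqP->|_] //; case: ifP => [|_]; lia.
Qed.

Lemma gen_far n (i j : 'I_n) : (i.+2 <= j) || (j.+2 <= i) -> (gen i * gen j = gen j * gen i)%g.
Proof.
move=> fij; apply/permP => p; apply/val_inj; rewrite !permM /= !gen_val.
move: fij; repeat (case: ifP => //=); lia.
Qed.

Lemma gen_braid n (i j : 'I_n) : j = i.+1 :> nat ->
  (gen i * gen j * gen i = gen j * gen i * gen j)%g.
Proof.
move=> ji; apply/permP => p; apply/val_inj; rewrite !permM /= !gen_val.
move: ji; repeat (case: ifP => //=); lia.
Qed.

Lemma gen_near n (i j : 'I_n) : j = i.+1 :> nat ->
  (gen i * gen j != gen j * gen i)%g.
Proof.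
move=> ji; apply/eqP => /(congr1 (fun s : 'S_n.+1 => val (s (widen_ord (leqnSn n) i)))).
rewrite !permM /= !gen_val /= eqxx; move: ji; repeat (case: ifP => //=); lia.
Qed.

Lemma gen_noncomm n (i j : 'I_n) :
  ((gen i * gen j != gen j * gen i)%g) = (j == i.+1 :> nat) || (i == j.+1 :> nat).
Proof.
have [/eqP ji|ne1] := boolP (j == i.+1 :> nat); first by rewrite gen_near.
have [/eqP ij|ne2] := boolP (i == j.+1 :> nat); first by rewrite eq_sym gen_near.
have [->|ne] := eqVneq i j; first by rewrite eqxx.
rewrite gen_far ?eqxx //; move: ne1 ne2 ne; rewrite -val_eqE /=; lia.
Qed.

Lemma gen_order2 n (i j : 'I_n) :
  ((gen i * gen j) ^+ 2 = 1)%g <-> ~~ ((j == i.+1 :> nat) || (i == j.+1 :> nat)).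
Proof.
rewrite -gen_noncomm negbK expgS expg1; split.
  move/(canRL (mulgK _)); rewrite mul1g invMg !genV => /eqP.
  by [].
move/eqP => e; rewrite {2}e mulgA -(mulgA (gen i)) genK mulg1 genK //.
Qed.

(** Unless the indices are adjacent, the square of the product is already 1, so the cube is the
    product itself and is trivial only for [i = j]. The right-hand side therefore includes equal
    indices. *)
Lemma gen_order3 n (i j : 'I_n) :
  ((gen i * gen j) ^+ 3 = 1)%g <-> i <= j.+1 /\ j <= i.+1.
Proof.
have near (a b : 'I_n) : b = a.+1 :> nat -> ((gen a * gen b) ^+ 3 = 1)%g.
  move=> ab; rewrite !expgS expg0 mulg1 !mulgA gen_braid //.
  by rewrite -!mulgA (mulgA (gen b) (gen b)) genK mul1g (mulgA (gen a) (gen a)) genK mul1g genK.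
split=> [e3|[le1 le2]].
  have [/gen_order2 e2|] :=
    boolP (~~ ((j == i.+1 :> nat) || (i == j.+1 :> nat))); last lia.
  move: e3; rewrite expgSr e2 mul1g => /(canRL (mulgK _)).
  by rewrite mul1g genV => /gen_inj ->; rewrite !leqnSn.
have [ij|ne] := eqVneq i j; first by rewrite ij genK expg1n.
have [ji|ne'] := eqVneq (j : nat) i.+1; first exact: near.
have ij : i = j.+1 :> nat by move: ne; rewrite -val_eqE /=; lia.
by have := congr1 (fun s => s^-1)%g (near j i ij); rewrite -expVgn invMg !genV invg1.
Qed.

(** * Reduced words and crossing strands *)

Lemma word_prod_cat n (u v : seq 'I_n) :
  word_prod (u ++ v) = (word_prod u * word_prod v)%g.
Proof. exact: big_cat. Qed.

Lemma word_prod_cons n i (u : seq 'I_n) :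
  word_prod (i :: u) = (gen i * word_prod u)%g.
Proof. exact: big_cons. Qed.

Lemma word_prod_rcons n i (u : seq 'I_n) :
  word_prod (rcons u i) = (word_prod u * gen i)%g.
Proof. by rewrite -cats1 word_prod_cat /word_prod big_seq1. Qed.

Lemma word_prod_nil n : word_prod (Nil 'I_n) = 1%g.
Proof. exact: big_nil. Qed.

(** A generator conjugates a transposition of points at distance [d + 1] into one at distance [d],
    so every transposition is a product of generators. *)
Lemma word_prod_surj n (w : 'S_n.+1) : exists u, word_prod u = w.
Proof.
have tp d (a b : 'I_n.+1) : b = a + d :> nat -> exists u, word_prod u = tperm a b.
  elim: d b => [|d IHd] b ba.
    by exists [::]; rewrite word_prod_nil (_ : b = a) ?tperm1 //; apply/val_inj; rewrite /= ba addn0.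
  have [d0|d_gt0] := posnP d.
    have an : a < n by have := ltn_ord b; lia.
    exists [:: Ordinal an]; rewrite /word_prod big_seq1 /gen; congr tperm; apply/val_inj => //=.
    by rewrite /bump /=; lia.
  have bn : b.-1 < n by have := ltn_ord b; lia.
  pose b' := widen_ord (leqnSn n) (Ordinal bn).
  have [|u uP] := IHd b'; first by rewrite /=; lia.
  exists (Ordinal bn :: rcons u (Ordinal bn)).
  rewrite word_prod_cons word_prod_rcons uP mulgA -{1}genV -mulgA -conjgE tpermJ.
  congr tperm; apply/val_inj; rewrite /= gen_val /=; repeat (case: ifP => //=); lia.
have tp' (a b : 'I_n.+1) : exists u, word_prod u = tperm a b.
  case: (leqP a b) => [/subnKC/esym /tp //|/ltnW/subnKC/esym /tp].
  by rewrite tpermC.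
have [ts -> _] := prod_tpermP w.
elim: ts => [|t ts [u IH]]; first by exists [::]; rewrite word_prod_nil big_nil.
have [v vP] := tp' t.1 t.2.
by exists (v ++ u); rewrite word_prod_cat big_cons vP IH.
Qed.

Lemma reduced_exists n (w : 'S_n.+1) : exists u, reduced_expr w u.
Proof.
have ex : exists k, `[< exists2 u : seq 'I_n, word_prod u = w & size u = k >].
  by have [u uw] := word_prod_surj w; exists (size u); apply/asboolP; exists u.
have [k /asboolP [u uw uk] kmin] := ex_minnP ex.
by exists u; split=> // v vw; rewrite uk; apply: kmin; apply/asboolP; exists v.
Qed.

(* The strand starting at [x] is at position [strand u t x] after [t] letters. *)
Definition strand n (u : seq 'I_n) t (x : 'I_n.+1) : 'I_n.+1 :=
  word_prod (take t u) x.

Lemma strand0 n (u : seq 'I_n) x : strand u 0 x = x.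
Proof. by rewrite /strand take0 word_prod_nil perm1. Qed.

Lemma strand_inj n (u : seq 'I_n) t : injective (strand u t).
Proof. exact: perm_inj. Qed.

Lemma strand_size n (u : seq 'I_n) x : strand u (size u) x = word_prod u x.
Proof. by rewrite /strand take_size. Qed.

Lemma take_label n (u : seq 'I_n) (a : heap u) :
  take a.+1 u = rcons (take a u) (label a).
Proof. by rewrite (take_nth (label a)) ?ltn_ord // {2}/label (tnth_nth (label a)). Qed.

Lemma cat_label n (u : seq 'I_n) (a : heap u) :
  u = take a u ++ label a :: drop a.+1 u.
Proof. by rewrite -cat_rcons -take_label cat_take_drop. Qed.

Lemma word_prod_label n (u : seq 'I_n) (a : heap u) : word_prod u =
  (word_prod (take a u) * gen (label a) * word_prod (drop a.+1 u))%g.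
Proof. by rewrite -word_prod_rcons -take_label -word_prod_cat cat_take_drop. Qed.

Lemma size_label n (u : seq 'I_n) (a : heap u) :
  size u = (size (take a u) + size (drop a.+1 u)).+1.
Proof. by have := congr1 size (cat_label a); rewrite size_cat /= addnS. Qed.

Lemma strandS n (u : seq 'I_n) (a : heap u) x :
  strand u a.+1 x = gen (label a) (strand u a x).
Proof. by rewrite /strand take_label word_prod_rcons permM. Qed.

(** The order of the arguments records a direction: [x] is the strand that letter [a] moves up. A
    letter undoing a crossing of [x] and [y] satisfies [crosses a y x]. *)
Definition crosses n (u : seq 'I_n) (a : heap u) (x y : 'I_n.+1) :=
  (strand u a x == label a :> nat) && (strand u a y == (label a).+1 :> nat).

Lemma crosses_exists n (u : seq 'I_n) (a : heap u) : exists x y, crosses a x y.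
Proof.
exists ((word_prod (take a u))^-1%g (widen_ord (leqnSn n) (label a))).
exists ((word_prod (take a u))^-1%g (lift ord0 (label a))).
by rewrite /crosses /strand !permKV /= /bump !eqxx.
Qed.

Lemma crossing_time n (u : seq 'I_n) t (x y : 'I_n.+1) : t <= size u -> x < y ->
  strand u t y < strand u t x -> exists a : heap u, a < t /\ crosses a x y.
Proof.
elim: t => [|t IHt] tu xy; first by rewrite !strand0; lia.
case: (ltnP (strand u t y) (strand u t x)) => [lt _|].
  have [a [at_ cr]] := IHt (ltnW tu) xy lt.
  by exists a; split=> //; lia.
pose a : heap u := Ordinal tu; move=> le.
rewrite -[t.+1]/(a.+1) !strandS !gen_val => lt; exists a; split=> //; rewrite /crosses.
have ne : strand u t x != strand u t y :> nat.
  by rewrite val_eqE (inj_eq (@strand_inj _ u t)) -val_eqE /= neq_ltn xy.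
have aE : a = t :> nat by [].
move: lt ne le; rewrite aE; repeat (case: ifP => //=); lia.
Qed.

Lemma mul_gen_strand n (W : 'S_n.+1) (i : 'I_n) (x y : 'I_n.+1) :
  W x = i :> nat -> W y = i.+1 :> nat -> (W * gen i = tperm x y * W)%g.
Proof.
by move=> xi yi; rewrite [RHS]conjgC tpermJ; congr (_ * tperm _ _)%g; apply/val_inj => //=.
Qed.

(** The strong exchange condition: the deleted letter is the one at which the two strands cross, and
    deleting it multiplies the product by their transposition. *)
Lemma exchange n (u : seq 'I_n) (x y : 'I_n.+1) : x < y ->
    word_prod u y < word_prod u x ->
  exists2 u', (size u').+1 = size u & (word_prod u = tperm x y * word_prod u')%g.
Proof.
rewrite -!strand_size => xy /(crossing_time (leqnn _) xy) [a [_ /andP[/eqP xa /eqP ya]]].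
exists (take a u ++ drop a.+1 u).
  by rewrite size_cat -size_label.
rewrite (word_prod_label a) word_prod_cat mulgA.
by rewrite (mul_gen_strand (x := x) (y := y)).
Qed.

(** If [a] undid a crossing, [exchange] would delete a letter before [a] at the cost of the same
    transposition. Deleting both letters would keep the product and shorten the word. *)
Lemma reduced_crosses_lt n (w : 'S_n.+1) u (a : heap u) x y :
  reduced_expr w u -> crosses a x y -> x < y.
Proof.
move=> [uw min] /andP[/eqP xa /eqP ya].
case: (ltngtP x y) => // [yx|/val_inj e]; last by move: xa ya; rewrite e => -> /n_Sn.
have [|u' su' u'E] := exchange (u := take a u) yx; first by rewrite -/(strand u a y) -/(strand u a x) xa ya.
suff /min : word_prod (u' ++ drop a.+1 u) = w.
  by rewrite size_cat; have := size_label a; lia.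
rewrite -uw (word_prod_label a) word_prod_cat.
by rewrite (mul_gen_strand (x := x) (y := y)) // u'E mulgA tpermC tperm2 mul1g.
Qed.

(** No letter of a reduced word undoes a crossing, by [reduced_crosses_lt], so crossed strands stay
    crossed. *)
Lemma reduced_crossed n (w : 'S_n.+1) u s t (x y : 'I_n.+1) : reduced_expr w u ->
  x < y -> s <= t <= size u -> strand u s y < strand u s x ->
  strand u t y < strand u t x.
Proof.
move=> ru xy /andP[st tu] cr; elim: t st tu => [|t IHt] st tu.
  by move: cr; rewrite (_ : s = 0) //; lia.
have [<- //|ne] := eqVneq s t.+1.
have {IHt} : strand u t y < strand u t x by apply: IHt; lia.
pose a : heap u := Ordinal tu; have aE : a = t :> nat by [].
have := @reduced_crosses_lt _ _ _ a y x ru; rewrite /crosses -aE !strandS !gen_val.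
by repeat (case: ifP => //=); lia.
Qed.

Lemma crosses_after n (u : seq 'I_n) (a : heap u) x y :
  crosses a x y -> strand u a.+1 y < strand u a.+1 x.
Proof.
by move=> /andP[/eqP xa /eqP ya]; rewrite !strandS !gen_val; repeat (case: ifP => //=); lia.
Qed.

Lemma crosses_before n (u : seq 'I_n) (a : heap u) x y :
  crosses a x y -> strand u a x < strand u a y.
Proof. by move=> /andP[/eqP -> /eqP ->]. Qed.

Lemma crosses_uniq n (w : 'S_n.+1) u (a b : heap u) x y : reduced_expr w u ->
  crosses a x y -> crosses b x y -> a = b.
Proof.
move=> ru; wlog ab : a b / a <= b => [hw ca cb|ca cb].
  by case: (leqP a b) => [|/ltnW] le; [apply: hw|apply/esym/hw].
apply/val_inj/eqP; rewrite eqn_leq ab /= leqNgt; apply/negP => lt.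
have xy := reduced_crosses_lt ru ca.
have := @reduced_crossed _ _ _ a.+1 b _ _ ru xy; rewrite lt ltnW //.
by move=> /(_ isT (crosses_after ca)); have := crosses_before cb; lia.
Qed.

Lemma crosses_inv n (w : 'S_n.+1) u (a : heap u) x y : reduced_expr w u ->
  crosses a x y -> w y < w x.
Proof.
move=> ru ca; rewrite -(proj1 ru) -!strand_size.
apply: (reduced_crossed ru (reduced_crosses_lt ru ca) _ (crosses_after ca)).
by rewrite ltn_ord leqnn.
Qed.

(** * Full commutativity and pattern avoidance *)

Lemma comm_class_perm n (u v : seq 'I_n) : same_comm_class u v -> perm_eq u v.
Proof.
elim=> [{}u {}v [p [q [i [j [_ -> ->]]]]]|{}u //|x y z _ xy _]; last exact: perm_trans.
by rewrite perm_cat2l -[_ ++ q in X in perm_eq X]/([:: i] ++ [:: j] ++ q) perm_catCA.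
Qed.

(** At such a descent, [exchange] turns a reduced word of [w] into a word of [w * gen i] with one
    letter less, so appending [i] to a reduced word of the latter reaches the length of [w]. *)
Lemma reduced_rcons n (w : 'S_n.+1) (i : 'I_n) v :
    (w^-1)%g (lift ord0 i) < (w^-1)%g (widen_ord (leqnSn n) i) ->
  reduced_expr (w * gen i)%g v -> reduced_expr w (rcons v i).
Proof.
set y := (w^-1)%g _; set x := (w^-1)%g _; move=> yx [vw vmin].
have uw : word_prod (rcons v i) = w by rewrite word_prod_rcons vw -mulgA genK mulg1.
split=> // u' u'w; rewrite size_rcons ltnNge; apply/negP => le.
have [u [uE umin]] := reduced_exists w.
have wx : w x = i :> nat by rewrite /x permKV.
have wy : w y = i.+1 :> nat by rewrite /y permKV.
have [|u1 su1 u1E] := exchange (u := u) yx; first by rewrite uE wx wy.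
have : word_prod u1 = (w * gen i)%g.
  by rewrite (mul_gen_strand wx wy) -uE u1E mulgA tpermC tperm2 mul1g.
by move/vmin; have := umin u' u'w; lia.
Qed.

Lemma descent_between n (w : 'S_n.+1) (c b : 'I_n.+1) : c < b ->
    (w^-1)%g b < (w^-1)%g c ->
  exists i : 'I_n, [/\ c <= i, i < b &
    (w^-1)%g (lift ord0 i) < (w^-1)%g (widen_ord (leqnSn n) i)].
Proof.
move=> cb; have [d] := ubnP (b - c); elim: d b cb => // d IHd b cb bc lt.
have bn : b.-1 < n by have := ltn_ord b; lia.
pose i := Ordinal bn.
have bE : lift ord0 i = b by apply/val_inj => /=; rewrite /bump /=; lia.
pose b' := widen_ord (leqnSn n) i; have b'E : b' = b.-1 :> nat by [].
case: (ltnP ((w^-1)%g b) ((w^-1)%g b')) => [ltb|leb].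
  by exists i; split=> //=; rewrite ?bE //; lia.
have cb' : c < b'.
  have [e|] := eqVneq (b' : nat) c; last by lia.
  by move: leb; rewrite (val_inj e) /=; lia.
have [||i' [ci ib id]] := IHd b' cb'; [lia|by apply: leq_ltn_trans lt|].
by exists i'; split=> //; lia.
Qed.

Lemma pattern_gen n (w : 'S_n.+1) (i : 'I_n) (x y : 'I_n.+1) : w y < w x ->
  ~~ ((w y == i :> nat) && (w x == i.+1 :> nat)) -> (w * gen i)%g y < (w * gen i)%g x.
Proof. by rewrite !permM !gen_val; repeat (case: ifP => //=); lia. Qed.

(** Induction on the length: as long as a last letter can be split off without destroying the 321
    pattern, do so and append it again to both words. When this stops, [w] has reduced words ending
    in the two sides of a braid relation, and these sides have different letter counts. *)
Lemma letter_counts_321 n (w : 'S_n.+1) : ~ avoids321 w ->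
  exists v1 v2, [/\ reduced_expr w v1, reduced_expr w v2 & ~~ perm_eq v1 v2].
Proof.
have [u [uw _]] := reduced_exists w.
have [d] := ubnP (size u); elim: d w u uw => // d IHd w u0 u0w u0d n321.
have {u0 u0w u0d} [u ru ud] : exists2 u, reduced_expr w u & size u < d.+1.
  have [u ru] := reduced_exists w; exists u => //.
  by apply: leq_ltn_trans u0d; apply: (proj2 ru).
have {n321} [x [y [z [xy yz yx zy]]]] :
  exists x y z : 'I_n.+1, [/\ x < y, y < z, w y < w x & w z < w y].
  by apply: contrapT => no; apply: n321 => -[x [y [z h]]]; apply: no; exists x, y, z.
have shorten (i : 'I_n) : (w^-1)%g (lift ord0 i) < (w^-1)%g (widen_ord (leqnSn n) i) ->
    ~ avoids321 (w * gen i)%g ->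
    exists v1 v2, [/\ reduced_expr w v1, reduced_expr w v2 & ~~ perm_eq v1 v2].
  move=> di ni; have [v rv] := reduced_exists (w * gen i)%g.
  have rvi := reduced_rcons di rv.
  have [|v1 [v2 [r1 r2 ne]]] := IHd (w * gen i)%g v (proj1 rv) _ ni.
    by have := (proj2 rvi) u (proj1 ru); rewrite size_rcons; lia.
  exists (rcons v1 i), (rcons v2 i); split; try exact: reduced_rcons.
  by rewrite -!cats1 perm_cat2r.
have keep (i : 'I_n) : ~~ ((w z == i :> nat) && (w y == i.+1 :> nat)) ->
    ~~ ((w y == i :> nat) && (w x == i.+1 :> nat)) -> ~ avoids321 (w * gen i)%g.
  by move=> n1 n2; apply; exists x, y, z; split=> //; apply: pattern_gen.
(* Possible last letters: [i] at a descent between the two lower values of the pattern, [j] at one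
   between the two upper values. Splitting one off spoils the pattern only if it exchanges exactly
   those two values. *)
have [|i [ci ib di]] := descent_between (w := w) zy; first by rewrite !permK.
have [|j [bj ja dj]] := descent_between (w := w) yx; first by rewrite !permK.
have [/andP[/eqP zi /eqP yi]|ni] := boolP ((w z == i :> nat) && (w y == i.+1 :> nat)); last first.
  by apply: (shorten i di); apply: keep => //; lia.
have [/andP[/eqP yj /eqP xj]|nj] := boolP ((w y == j :> nat) && (w x == j.+1 :> nat)); last first.
  by apply: (shorten j dj); apply: keep => //; lia.
(* In the remaining case the pattern takes the consecutive values [i], [i + 1], [i + 2]. *)
have xz := ltn_trans xy yz.
have ij : j = i.+1 :> nat by lia.
have desc (s : 'S_n.+1) (k : 'I_n) (p q : 'I_n.+1) : s p = k.+1 :> nat -> s q = k :> nat ->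
    p < q -> (s^-1)%g (lift ord0 k) < (s^-1)%g (widen_ord (leqnSn n) k).
  move=> pk qk pq; rewrite (_ : lift ord0 k = s p); last by apply/val_inj => /=; rewrite pk.
  by rewrite (_ : widen_ord _ _ = s q) ?permK //; apply/val_inj => /=; rewrite qk.
have [v rv] := reduced_exists (w * gen i * gen j * gen i)%g.
have val (s : 'S_n.+1) (k : 'I_n) p : (s * gen k)%g p = gen k (s p) :> 'I_n.+1 by rewrite permM.
exists (rcons (rcons (rcons v i) j) i), (rcons (rcons (rcons v j) i) j).
split.
- apply: reduced_rcons; first exact: di.
  apply: reduced_rcons; first apply: (@desc _ j x z) => //.
  + by rewrite val gen_val xj ij; repeat (case: ifP => //=); lia.
  + by rewrite val gen_val zi ij; repeat (case: ifP => //=); lia.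
  apply: reduced_rcons => //; apply: (@desc _ i x y) => //.
  + by rewrite !val !gen_val xj ij; repeat (case: ifP => //=); lia.
  + by rewrite !val !gen_val yi ij; repeat (case: ifP => //=); lia.
- apply: reduced_rcons; first exact: dj.
  apply: reduced_rcons; first apply: (@desc _ i x z) => //.
  + by rewrite val gen_val xj ij; repeat (case: ifP => //=); lia.
  + by rewrite val gen_val zi ij; repeat (case: ifP => //=); lia.
  apply: reduced_rcons; first apply: (@desc _ j y z) => //.
  + by rewrite !val !gen_val yj ij; repeat (case: ifP => //=); lia.
  + by rewrite !val !gen_val zi ij; repeat (case: ifP => //=); lia.
  by move: rv; rewrite -!mulgA !(mulgA (gen i)) gen_braid // -!mulgA.
(* Beyond the common prefix [v], the first word has two letters [i] and the second has one. *)
apply/negP => /seq.permP /(_ (pred1 i)); rewrite -!cats1 !count_cat /= eqxx.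
by have -> : (j == i) = false; [rewrite -val_eqE /= ij; lia | lia].
Qed.

(** Commutation moves only permute the letters, so all words of a commutativity class have the same
    letter counts. *)
Lemma fully_commutative_avoids321 n (w : 'S_n.+1) :
  fully_commutative w -> avoids321 w.
Proof.
move=> [u ru comm]; apply: contrapT => /letter_counts_321 [v1 [v2 [r1 r2 /negP[]]]].
by apply: (perm_trans (y := u)); [rewrite perm_sym|]; apply/comm_class_perm/comm.
Qed.

(** * Ranks *)

Definition rank N (P : pred 'I_N) (p : nat) : nat := #|[set x : 'I_N | (x < p) && P x]|.

Lemma rank0 N (P : pred 'I_N) : rank P 0 = 0.
Proof. by apply/eqP; rewrite cards_eq0; apply/eqP/setP=> x; rewrite !inE. Qed.

Lemma rankS N (P : pred 'I_N) (x : 'I_N) : rank P x.+1 = rank P x + P x.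
Proof.
rewrite /rank addnC; case: (boolP (P x)) => Px.
  rewrite (cardsD1 x) !inE ltnSn Px; congr (_ + _); apply: eq_card => y.
  by rewrite !inE -val_eqE /=; case: (P y); rewrite ?andbF ?andbT //; lia.
apply: eq_card => y; rewrite !inE ltnS leq_eqVlt.
by have [/val_inj ->|] := eqVneq (y : nat) x; rewrite //= (negPf Px) !andbF.
Qed.

Lemma rank_over N (P : pred 'I_N) p : N <= p -> rank P p = rank P N.
Proof. by move=> Np; apply: eq_card => x; have := ltn_ord x; rewrite !inE => ?; congr andb; lia. Qed.

Lemma rank_step N (P : pred 'I_N) p : rank P p <= rank P p.+1 <= (rank P p).+1.
Proof.
case: (ltnP p N) => pN; last by rewrite !rank_over ?leqnn ?leqnSn //; lia.
by rewrite (rankS P (Ordinal pN)) /=; case: (P _) => /=; lia.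
Qed.

Definition steps (c : nat -> nat) := forall p, c p <= c p.+1 <= (c p).+1.

Lemma steps_le c p q : steps c -> p <= q -> c p <= c q <= c p + (q - p).
Proof.
move=> cs /subnK <-; rewrite addnK; elim: (q - p) => [|d IH]; first by rewrite addn0 leqnn.
by have := cs (d + p); rewrite addSn; lia.
Qed.

Lemma rank_le N (P : pred 'I_N) p q : p <= q -> rank P p <= rank P q <= rank P p + (q - p).
Proof. by apply: steps_le => r; apply: rank_step. Qed.

Lemma rankC N (P : pred 'I_N) p : p <= N -> rank P p + rank (predC P) p = p.
Proof.
elim: p => [|p IHp] pN; first by rewrite !rank0.
have := IHp (ltnW pN); rewrite !(rankS _ (Ordinal pN)) /=.
by case: (P _) => /=; lia.
Qed.

Lemma card_ord_lt N (z : 'I_N) : #|[set v : 'I_N | v < z]| = z.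
Proof.
have := rankC predT (ltnW (ltn_ord z)); rewrite {2}/rank (_ : [set x | _] = set0).
  by rewrite cards0 addn0 => e; rewrite -[RHS]e; apply: eq_card => v; rewrite !inE andbT.
by apply/setP => v; rewrite !inE andbF.
Qed.

Lemma rank_ivt N (P : pred 'I_N) p k :
  k < rank P p -> exists x : 'I_N, [/\ x < p, P x & rank P x = k].
Proof.
elim: p => [|p IHp]; first by rewrite rank0.
case: (ltnP k (rank P p)) => [/IHp [x [xp Px <-]] _|le].
  by exists x; split=> //; apply: ltnW.
case: (ltnP p N) => pN; last first.
  by rewrite (rank_over P (leqW pN)) -(rank_over P pN) ltnNge le.
rewrite (rankS _ (Ordinal pN)) /=; case PE: (P _); rewrite /= ?addn0 ?ltnNge ?le //.
move=> lt; exists (Ordinal pN); split=> //=; lia.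
Qed.

Lemma rank_ltP N (P : pred 'I_N) (x y : 'I_N) : P x -> P y ->
  (rank P x < rank P y) = (x < y).
Proof.
move=> Px Py; case: (ltnP x y) => xy.
  by have := rank_le P xy; rewrite rankS Px; lia.
by have := rank_le P xy; lia.
Qed.

Lemma rank_inj N (P : pred 'I_N) (x y : 'I_N) : P x -> P y -> rank P x = rank P y -> x = y.
Proof.
move=> Px Py e; have := rank_ltP Px Py; have := rank_ltP Py Px.
by rewrite e ltnn; case: ltngtP => // /val_inj.
Qed.

Lemma rank_perm N (w : {perm 'I_N}) (P Q : pred 'I_N) (x : 'I_N) :
    (forall z, Q (w z) = P z) -> P x ->
    (forall z, P z -> (w z < w x) = (z < x)) ->
  rank Q (w x) = rank P x.
Proof.
move=> QP Px mono; rewrite /rank -[RHS](card_imset _ (@perm_inj _ w)); apply: eq_card => y.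
rewrite -[y](permKV w) inE mem_imset; last exact: perm_inj.
by rewrite inE QP; case Pz: (P _); rewrite ?andbF ?andbT ?mono.
Qed.

(** * Staircase regions *)

(* Cell (j, k) of the region satisfies lo j <= k < hi j. Put l = j - k: the
   order is (j, k) <= (j', k') iff k' <= k and l <= l', and the condition on
   the steps says that the region is a skew shape in the coordinates (k, l).
   The condition on column 0 allows empty columns to be added on its left. *)
Definition staircase (lo hi : nat -> nat) :=
  [/\ steps lo, steps hi & hi 0 <= (lo 0).+1].

(** With [l = j - k], the last two conditions are [l1 <= l <= l2], written additively because
    subtraction on [nat] truncates. *)
Definition between (j1 k1 j k j2 k2 : nat) :=
  [/\ k2 <= k <= k1, j1 + k <= j + k1 & j + k2 <= j2 + k].

(** To the right of [j1], [hi] stays above [k1 >= k]; to the left it falls by at most one per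
    column, and the bound on [k] falls by one per column. The same comparison of [lo] with column
    [j2] gives the lower bound. *)
Lemma staircase_convex lo hi j1 k1 j k j2 k2 : staircase lo hi ->
    lo j1 <= k1 < hi j1 -> lo j2 <= k2 < hi j2 -> between j1 k1 j k j2 k2 ->
  lo j <= k < hi j.
Proof.
move=> [los his _] c1 c2 [kb jb1 jb2].
have h1 := steps_le (p := j1) (q := j) his; have h2 := steps_le (p := j) (q := j1) his.
have l1 := steps_le (p := j2) (q := j) los; have l2 := steps_le (p := j) (q := j2) los.
have : lo j <= k by case: (leqP j j2) => [/l2|/ltnW/l1]; lia.
have : k < hi j by case: (leqP j1 j) => [/h1|/ltnW/h2]; lia.
lia.
Qed.

(* The point between the two cells lies in column -d.+1. *)
Lemma staircase_convex_left lo hi j1 k1 d k j2 k2 : staircase lo hi ->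
    lo j1 <= k1 < hi j1 -> lo j2 <= k2 < hi j2 ->
    k2 <= k <= k1 -> d.+1 + j1 + k <= k1 -> False.
Proof.
move=> [los his h0] c1 c2 kb jb.
have := steps_le his (leq0n j1); have := steps_le los (leq0n j2); lia.
Qed.

(** * Heaps of 321-avoiding permutations *)

Definition exc n (w : 'S_n.+1) : pred 'I_n.+1 := fun x => x <= w x.
Definition excv n (w : 'S_n.+1) : pred 'I_n.+1 := fun y => (w^-1)%g y <= y.

(** Column [j] lies between the positions [j] and [j.+1], hence the count over the first [j.+1]
    positions. *)
Definition lo_of n (w : 'S_n.+1) j := rank (excv w) j.+1.
Definition hi_of n (w : 'S_n.+1) j := rank (exc w) j.+1.

(** An isomorphism of labeled posets from the heap of [u] onto the region between [lo] and [hi],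
    sending [a] to the cell [(label a, k a)]. *)
Definition cell_model n (u : seq 'I_n) (lo hi : nat -> nat) := exists k : heap u -> nat,
  [/\ forall a, lo (label a) <= k a < hi (label a),
      forall a b, label a = label b -> k a = k b -> a = b,
      forall j l, lo j <= l < hi j -> exists a, label a = j :> nat /\ k a = l
    & forall a b, heap_lt a b = [&& a != b, k b <= k a & label a + k b <= label b + k a]].

Lemma avoids321V n (w : 'S_n.+1) : avoids321 w -> avoids321 (w^-1)%g.
Proof.
move=> av [i [j [k [ij jk wji wkj]]]]; apply: av.
by exists ((w^-1)%g k), ((w^-1)%g j), ((w^-1)%g i); rewrite !permKV.
Qed.

(** Suppose [w x <= x]. The [x] points before [x] and the point [y] cannot all have values below
    [w x], by counting; hence some [p < x] has [w p > w x], and [p], [x], [y] form a 321 pattern. *)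
Lemma avoids321_exc n (w : 'S_n.+1) (x y : 'I_n.+1) : avoids321 w ->
  x < y -> w y < w x -> x < w x.
Proof.
move=> av xy wyx; rewrite ltnNge; apply/negP => wxx.
have [p [px wpx]] : exists p : 'I_n.+1, p < x /\ w x < w p.
  apply: contrapT => no.
  have sub : w @: (y |: [set p : 'I_n.+1 | p < x]) \subset [set v : 'I_n.+1 | v < w x].
    apply/subsetP => _ /imsetP[p pin ->]; rewrite inE.
    move: pin; rewrite !inE => /orP[/eqP-> //|px].
    rewrite ltnNge leq_eqVlt; apply/negP => /orP[/eqP/val_inj/perm_inj e|lt].
      by move: px; rewrite e ltnn.
    by apply: no; exists p.
  have := subset_leq_card sub; rewrite card_imset; last exact: perm_inj.
  by rewrite cardsU1 !card_ord_lt inE; lia.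
by apply: av; exists p, x, y.
Qed.

Lemma avoids321_nexc n (w : 'S_n.+1) (x y : 'I_n.+1) : avoids321 w ->
  x < y -> w y < w x -> w y < y.
Proof.
by move=> /avoids321V av xy yx; have := avoids321_exc av yx; rewrite !permK; apply.
Qed.

Lemma heap_lt_ltn m (v : seq 'I_m) (a b : heap v) : heap_lt a b -> a < b.
Proof.
move=> /andP[ne /connectP[p pth bE]].
suff : a <= b by rewrite leq_eqVlt val_eqE (negPf ne).
rewrite bE => {b ne bE}; elim: p a pth => //= c p IHp a /andP[/andP[/ltnW ac _]].
by move=> /IHp; apply: leq_trans.
Qed.

Section Avoider.
Variables (n : nat) (w : 'S_n.+1).
Hypothesis av : avoids321 w.

Lemma exc_mono (x y : 'I_n.+1) : exc w x -> exc w y -> (w x < w y) = (x < y).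
Proof.
have mono (a b : 'I_n.+1) : exc w b -> a < b -> w a < w b.
  rewrite /exc => eb ab; rewrite ltn_neqAle val_eqE (inj_eq perm_inj) -val_eqE /=.
  rewrite (ltn_eqF ab) leqNgt; apply/negP => /(avoids321_nexc av ab); lia.
move=> ex ey; apply/idP/idP; last exact: mono.
rewrite !ltnNge; apply: contra; rewrite leq_eqVlt => /orP[/eqP/val_inj-> //|/mono].
by move=> /(_ ex)/ltnW.
Qed.

Lemma nexc_mono (x y : 'I_n.+1) : ~~ exc w x -> ~~ exc w y -> (w x < w y) = (x < y).
Proof.
have mono (a b : 'I_n.+1) : ~~ exc w a -> a < b -> w a < w b.
  rewrite /exc => eb ab; rewrite ltn_neqAle val_eqE (inj_eq perm_inj) -val_eqE /=.
  rewrite (ltn_eqF ab) leqNgt; apply/negP => /(avoids321_exc av ab); lia.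
move=> ex ey; apply/idP/idP; last exact: mono.
rewrite !ltnNge; apply: contra; rewrite leq_eqVlt => /orP[/eqP/val_inj-> //|/mono].
by move=> /(_ ey)/ltnW.
Qed.

Lemma rank_exc x : exc w x -> rank (excv w) (w x) = rank (exc w) x.
Proof.
move=> ex; apply: rank_perm => // [z|z ez]; first by rewrite /excv permK.
exact: exc_mono.
Qed.

Lemma rank_nexc x : ~~ exc w x ->
  rank (predC (excv w)) (w x) = rank (predC (exc w)) x.
Proof.
move=> ex; apply: rank_perm => // [z|z ez]; first by rewrite /= /excv permK.
exact: nexc_mono.
Qed.

Lemma rank_exc_total : rank (excv w) n.+1 = rank (exc w) n.+1.
Proof.
rewrite /rank -[RHS](card_imset _ (@perm_inj _ w)); apply: eq_card => y.
rewrite -[y](permKV w) inE mem_imset; last exact: perm_inj.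
by rewrite inE /excv permK !ltn_ord.
Qed.

Lemma rank_exc_over p : n < p -> rank (excv w) p = rank (exc w) p.
Proof. by move=> np; rewrite !(rank_over _ np) rank_exc_total. Qed.

Lemma staircase_of : staircase (lo_of w) (hi_of w).
Proof.
split=> [p|p|]; rewrite /lo_of /hi_of; try exact: rank_step.
by have := rank_step (exc w) 0; rewrite rank0; lia.
Qed.

(** The two ranks in [j] are taken at [x] and at [y]. Taken at the same point they would add up to
    that point, so [x <= j < y] by monotonicity. The same argument on values gives [w y <= j < w x],
    and the bounds on the cell follow. *)
Lemma crossing_cell (x y : 'I_n.+1) : x < y -> w y < w x ->
    let j := rank (exc w) x + rank (predC (exc w)) y in
  [/\ lo_of w j <= rank (exc w) x < hi_of w j, x <= j < y & w y <= j < w x].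
Proof.
move=> xy yx j.
have ex : exc w x by apply/ltnW/(avoids321_exc av xy).
have ey : ~~ exc w y by rewrite /exc -ltnNge; apply: (avoids321_nexc av xy).
have xS := rankC (exc w) (ltnW (ltn_ord x)); have yS := rankC (exc w) (ltnW (ltn_ord y)).
have wxS := rankC (excv w) (ltnW (ltn_ord (w x))).
have wyS := rankC (excv w) (ltnW (ltn_ord (w y))).
have vx : excv w (w x) by rewrite /excv permK.
have vy : ~~ excv w (w y) by rewrite /excv permK.
have := rank_le (predC (exc w)) (ltnW xy); have := rank_le (predC (excv w)) yx.
have := rank_le (exc w) xy; have := rank_le (excv w) (ltnW yx).
rewrite !rankS ex /= vy (rank_exc ex) (rank_nexc ey) in wxS wyS * => /= l1 l2 l3 l4.
have xj : x <= j by lia.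
have jx : j < w x by rewrite /j; lia.
have jy : j < y by rewrite /j; lia.
have wyj : w y <= j by rewrite /j; lia.
split; [|lia|lia].
rewrite /lo_of /hi_of.
have := rank_le (excv w) jx; rewrite (rank_exc ex).
have := rank_le (exc w) (p := x.+1) (q := j.+1); rewrite rankS ex; lia.
Qed.

(** Here [x] is the exceedance of rank [k] and [y] the non-exceedance of rank [j - k]. The bound by
    [hi_of] puts [x] at most at [j] and [y] beyond it; the bound by [lo_of] does the opposite for
    their values. *)
Lemma cell_crossing j k : lo_of w j <= k < hi_of w j ->
  exists x y : 'I_n.+1, [/\ x < y, w y < w x, rank (exc w) x = k
    & rank (predC (exc w)) y = j - k] /\ k <= j < n.
Proof.
move=> /andP[lk kh].
have jn : j < n.
  by rewrite ltnNge; apply/negP => nj; move: lk kh; rewrite /lo_of /hi_of rank_exc_over //; lia.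
have [x [xj ex xk]] := rank_ivt kh.
have hS := rankC (exc w) (_ : j.+1 <= n.+1); have lS := rankC (excv w) (_ : j.+1 <= n.+1).
have TS := rankC (exc w) (leqnn n.+1); have TV := rankC (excv w) (leqnn n.+1).
have mV := rank_le (predC (excv w)) (_ : j.+1 <= n.+1).
have kj : k <= j by have := hS (ltnW jn); rewrite -/(hi_of w j); lia.
have lt : j - k < rank (predC (exc w)) n.+1.
  have := lS (ltnW jn); have := mV (ltnW jn); rewrite rank_exc_total in TV.
  by move: lk; rewrite /lo_of; lia.
have [y [_ ey yl]] := rank_ivt lt.
have jy : j < y.
  rewrite ltnNge; apply/negP => yj.
  have := rank_le (predC (exc w)) (p := y.+1) (q := j.+1) yj; rewrite rankS ey.
  by have := hS (ltnW jn); move: kh; rewrite /hi_of /=; lia.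
have wyj : w y <= j.
  rewrite leqNgt; apply/negP => wyj.
  have := rank_le (predC (excv w)) wyj; rewrite (rank_nexc ey).
  by have := lS (ltnW jn); move: lk; rewrite /lo_of /=; lia.
have jwx : j < w x.
  rewrite ltnNge; apply/negP => wxj.
  have vx : excv w (w x) by rewrite /excv permK.
  have := rank_le (excv w) (p := (w x).+1) (q := j.+1) wxj; rewrite rankS vx (rank_exc ex).
  by move: lk; rewrite /lo_of /=; lia.
by exists x, y; split; [split=> //|]; lia.
Qed.

Variable u : seq 'I_n.
Hypothesis ru : reduced_expr w u.

Lemma word_prod_reduced : word_prod u = w.
Proof. exact: proj1 ru. Qed.

Lemma strand_exc_mono t (x y : 'I_n.+1) : t <= size u ->
  exc w x = exc w y -> x < y -> strand u t x < strand u t y.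
Proof.
move=> tu e xy; rewrite ltn_neqAle val_eqE (inj_eq (@strand_inj _ u t)) -val_eqE /=.
rewrite (ltn_eqF xy) leqNgt; apply/negP => cr.
have := reduced_crossed ru xy _ cr; move=> /(_ (size u)); rewrite tu leqnn => /(_ isT).
rewrite !strand_size word_prod_reduced ltnNge.
case ey: (exc w y) e => ex; first by rewrite ltnW // exc_mono.
by rewrite ltnW // nexc_mono ?ex ?ey.
Qed.

Lemma crosses_exc (a : heap u) x y : crosses a x y -> [/\ x < y, w y < w x, exc w x & ~~ exc w y].
Proof.
move=> ca; have xy := reduced_crosses_lt ru ca; have yx := crosses_inv ru ca.
split=> //; first exact/ltnW/(avoids321_exc av xy).
by rewrite /exc -ltnNge (avoids321_nexc av xy).
Qed.

Lemma strand_exc_leE t (x z : 'I_n.+1) : t <= size u -> exc w x = exc w z ->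
  (strand u t z < strand u t x) = (z < x).
Proof.
move=> tu e; apply/idP/idP; last exact: strand_exc_mono.
rewrite !ltnNge; apply: contra; rewrite leq_eqVlt => /orP[/eqP/val_inj-> //|lt].
exact/ltnW/strand_exc_mono.
Qed.

(** [label a] is the number of strands to the left of [x] at time [a]. Strands of one class never
    cross, so these are the exceedances before [x] and, [y] being the next strand, the
    non-exceedances before [y]. *)
Lemma label_crosses (a : heap u) x y : crosses a x y ->
  rank (exc w) x + rank (predC (exc w)) y = label a.
Proof.
move=> ca; have [xy yx ex ey] := crosses_exc ca.
have au : a <= size u by apply/ltnW.
have /andP[/eqP xa /eqP ya] := ca.
rewrite -xa -(card_ord_lt (strand u a x)) -(card_imset _ (@perm_inj _ (word_prod (take a u))^-1%g)).
rewrite (_ : _ @: _ = [set z : 'I_n.+1 | strand u a z < strand u a x]); last first.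
  apply/setP => z; rewrite -[z](permK (word_prod (take a u))) mem_imset ?inE ?permK //.
  exact: perm_inj.
rewrite -(cardsID [set z | exc w z] [set z : 'I_n.+1 | strand u a z < strand u a x]).
congr (_ + _); apply: eq_card => z; rewrite !inE /=.
  rewrite andbC; case ez: (exc w z); rewrite ?andbF ?andbT //.
  by rewrite strand_exc_leE ?ex ?ez.
case ez: (exc w z); rewrite ?andbF //= andbT -(@strand_exc_leE a) ?ez; last 2 first.
- exact: au.
- by rewrite (negPf ey).
rewrite xa ya ltnS leq_eqVlt -xa val_eqE (inj_eq (@strand_inj _ u a)).
by case: eqVneq ez => // ->; rewrite ex.
Qed.

(** At time [a] the strands [x] and [y] are adjacent, [x'] is not to the left of [x] and [y'] not to
    the right of [y]. As the pairs differ, [x'] and [y'] have already crossed. *)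
Lemma crosses_order (a b : heap u) x y x' y' : crosses a x y -> crosses b x' y' ->
  x <= x' -> y' <= y -> (x, y) <> (x', y') -> b < a.
Proof.
move=> ca cb xx yy ne; have [xy yx ex ey] := crosses_exc ca.
have [xy' yx' ex' ey'] := crosses_exc cb.
have au : a <= size u by apply/ltnW.
have cr : strand u a y' < strand u a x'.
  have /andP[/eqP xa /eqP ya] := ca.
  have yE : strand u a y' = strand u a y \/ strand u a y' < strand u a y.
    move: yy; rewrite leq_eqVlt => /orP[/eqP/val_inj->|lt]; [by left|right].
    by rewrite strand_exc_leE // (negPf ey) (negPf ey').
  have xE : strand u a x = strand u a x' \/ strand u a x < strand u a x'.
    move: xx; rewrite leq_eqVlt => /orP[/eqP/val_inj->|lt]; [by left|right].
    by rewrite strand_exc_leE // ex ex'.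
  have n1 : strand u a x <> strand u a y' :> nat.
    by move=> /val_inj/strand_inj e; rewrite -e ex in ey'.
  have n2 : strand u a x' <> strand u a y :> nat.
    by move=> /val_inj/strand_inj e; rewrite -e ex' in ey.
  have n3 : strand u a x = strand u a x' -> strand u a y' = strand u a y -> False.
    by move=> /strand_inj e1 /strand_inj e2; apply: ne; rewrite e1 e2.
  case: xE yE => [e1|l1] [e2|l2]; first by case: n3.
  - by rewrite -e1; lia.
  - by rewrite e2; lia.
  - by lia.
rewrite ltnNge; apply/negP => ab.
have := reduced_crossed ru xy' _ cr; move=> /(_ b); rewrite ab ltnW // => /(_ isT).
by have := crosses_before cb; lia.
Qed.

Lemma avoider_cell_model : cell_model u (lo_of w) (hi_of w).
Proof.
have ex (a : heap u) : {xy : 'I_n.+1 * 'I_n.+1 | crosses a xy.1 xy.2}.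
  by apply: cid; have [x [y cr]] := crosses_exists a; exists (x, y).
pose X a := (sval (ex a)).1; pose Y a := (sval (ex a)).2.
have cr a : crosses a (X a) (Y a) by rewrite /X /Y; case: (ex a).
pose k a := rank (exc w) (X a).
have Xk a b : (k a < k b) = (X a < X b).
  by apply: rank_ltP; [case: (crosses_exc (cr a))|case: (crosses_exc (cr b))].
pose l a := rank (predC (exc w)) (Y a).
have Yl a b : (l a < l b) = (Y a < Y b).
  by apply: rank_ltP; [case: (crosses_exc (cr a))|case: (crosses_exc (cr b))].
have lab a : k a + l a = label a := label_crosses (cr a).
have range a : lo_of w (label a) <= k a < hi_of w (label a).
  have [xy yx _ _] := crosses_exc (cr a).
  by have [] := crossing_cell xy yx; rewrite (label_crosses (cr a)).
have inj a b : k a = k b -> l a = l b -> a = b.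
  move=> ka la; apply: (crosses_uniq ru (cr a)).
  have -> : X a = X b.
    by have := Xk a b; have := Xk b a; rewrite ka ltnn; case: ltngtP => // /val_inj.
  have -> : Y a = Y b.
    by have := Yl a b; have := Yl b a; rewrite la ltnn; case: ltngtP => // /val_inj.
  exact: cr.
have surj j i : lo_of w j <= i < hi_of w j -> exists a : heap u, label a = j :> nat /\ k a = i.
  move=> /cell_crossing [x [y [[xy yx xk yl] ij]]].
  have := crossing_time (u := u) (leqnn _) xy.
  rewrite !strand_size word_prod_reduced => /(_ yx) [a [_ ca]]; exists a.
  have /andP[/eqP xa /eqP ya] := ca; have /andP[/eqP xa' /eqP ya'] := cr a.
  have e1 : X a = x by apply: (@strand_inj _ u a); apply/val_inj; rewrite /= xa xa'.
  have e2 : Y a = y by apply: (@strand_inj _ u a); apply/val_inj; rewrite /= ya ya'.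
  by rewrite -lab /k /l e1 e2 xk yl; split=> //; lia.
have time a b : k b <= k a -> l a <= l b -> a != b -> a < b.
  move=> kk ll ne; apply: (crosses_order (cr b) (cr a)).
  - by rewrite leqNgt -Xk -leqNgt.
  - by rewrite leqNgt -Yl -leqNgt.
  - move=> [e1 e2]; case/eqP: ne; apply: (crosses_uniq ru (cr a)).
    by rewrite -e1 -e2.
(* In adjacent columns [k + l] differs by one, so the two cells are comparable in the order, and
   [time] excludes the wrong direction. *)
have rel_up (a b : heap u) : heap_rel a b -> k b <= k a /\ l a <= l b.
  move=> /andP[ab]; rewrite gen_noncomm => near.
  have ne : b != a by rewrite -val_eqE /= gtn_eqF.
  have [kk|kk] := leqP (k b) (k a); have [ll|ll] := leqP (l a) (l b) => //.
  - by exfalso; have := time b a; have := lab a; have := lab b; lia.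
  - by exfalso; have := time b a (ltnW kk); have := lab a; have := lab b; lia.
  - by exfalso; have := time b a (ltnW kk) (ltnW ll) ne; lia.
exists k; split=> // [a b la ka|a b].
  by apply: inj => //; have := lab a; have := lab b; rewrite la ka; lia.
apply/idP/idP => [/andP[-> /connectP[p pth ->]] /=|/and3P[ne kk jj]].
  have : k (last a p) <= k a /\ l a <= l (last a p).
    elim: p a pth => //= c p IHp a /andP[/rel_up [h1 h2] /IHp]; lia.
  by have := lab a; have := lab (last a p); lia.
rewrite /heap_lt ne /=.
have ll : l a <= l b by have := lab a; have := lab b; lia.
(* Walk from [a] to [b] by unit steps, first lowering [k], then raising [l]. Convexity keeps the
   walk in the region, and each step goes to an adjacent column. *)
have [d] := ubnP (k a - k b + (l b - l a)); elim: d a ne kk jj ll => // d IHd a ne kk jj ll ltd.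
have st := staircase_of.
have go c : k c <= k a /\ l a <= l c -> k b <= k c /\ l c <= l b ->
    k a + l c = (k c + l a).+1 -> connect (@heap_rel n u) a c -> connect (@heap_rel n u) a b.
  move=> c1 c2 c3 ac; have [<- //|nec] := eqVneq c b.
  apply: connect_trans ac _; apply: IHd => //; have := lab a; have := lab b; have := lab c; lia.
have [la lb] := (lab a, lab b).
have : k b < k a \/ (k b = k a /\ l a < l b).
  have [lt|e] : k b < k a \/ k b = k a by lia.
    by left.
  right; split=> //; rewrite ltn_neqAle ll andbT; apply/eqP => e'.
  by case/eqP: ne; apply: inj.
have rel (c : heap u) : a < c -> (label a == (label c).+1 :> nat) || (label c == (label a).+1 :> nat) ->
    connect (@heap_rel n u) a c.
  by move=> ac near; apply: connect1; rewrite /heap_rel ac gen_noncomm orbC.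
have ca := range a; have cb := range b.
case=> [lt|[e lt]].
  have [|c [cj ck]] := surj (label a).-1 (k a).-1.
    by apply: (staircase_convex st ca cb); split; lia.
  have lc := lab c; apply: (go c); [lia|lia|lia|apply: rel; last lia].
  by apply: time; [lia|lia|apply/eqP => ac; rewrite ac in ck lt; lia].
have [|c [cj ck]] := surj (label a).+1 (k a).
  by apply: (staircase_convex st ca cb); split; lia.
have lc := lab c; apply: (go c); [lia|lia|lia|apply: rel; last lia].
by apply: time; [lia|lia|apply/eqP => ac; rewrite ac in cj; lia].
Qed.

End Avoider.

(** * Diamonds *)

Section Diamonds.
Variables (n : nat) (u : seq 'I_n) (lo hi : nat -> nat) (k : heap u -> nat).
Hypothesis st : staircase lo hi.
Hypothesis rng : forall a, lo (label a) <= k a < hi (label a).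
Hypothesis inj : forall a b : heap u, label a = label b -> k a = k b -> a = b.
Hypothesis surj : forall j l, lo j <= l < hi j ->
  exists a : heap u, label a = j :> nat /\ k a = l.
Hypothesis ord : forall a b : heap u,
  heap_lt a b = [&& a != b, k b <= k a & label a + k b <= label b + k a].

Lemma cell_inj (a b : heap u) : label a = label b :> nat -> k a = k b -> a = b.
Proof. by move=> /val_inj; apply: inj. Qed.

Lemma cell_neq (a b : heap u) : a != b -> label a <> label b :> nat \/ k a <> k b.
Proof.
move=> ne; have [e|] := eqVneq (label a : nat) (label b); last by move/eqP; left.
by right=> ke; case/eqP: ne; apply: cell_inj.
Qed.

Lemma minimal_pairE (x y : heap u) :
  minimal_pair x y = (label x == label y) && (k x == (k y).+1).
Proof.
rewrite /minimal_pair; case: eqVneq => //= xy; rewrite ord.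
apply/idP/idP => [/andP[/and3P[ne le _] /negP no]|/eqP kxy].
  rewrite eqn_leq ltn_neqAle le andbT; apply/andP; split; last first.
    by apply/eqP => e; case: (cell_neq ne); rewrite ?xy // e.
  rewrite leqNgt; apply/negP => lt; apply: no.
  have cx := rng x; have cy := rng y.
  have [|z [zx zk]] := surj (j := label x) (l := (k y).+1); first by rewrite xy in cx *; lia.
  apply/existsP; exists z; rewrite -(inj_eq val_inj) /= zx eqxx /= !ord.
  have xz : x != z by apply/eqP => e; rewrite -e in zk; lia.
  have zy : z != y by apply/eqP => e; rewrite e in zk; lia.
  by rewrite xz zy /= -!xy zk zx; lia.
have ne : x != y by apply/eqP => e; rewrite e in kxy; lia.
rewrite ne xy kxy leqnSn leq_add2l leqnSn /=; apply/existsP => -[z /and3P[/eqP zx]].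
rewrite !ord zx xy kxy => /and3P[n1 ? ?] /and3P[n2 ? ?].
have zy : k z <> k y by case: (cell_neq n2); rewrite ?zx ?xy.
have xz : k x <> k z by case: (cell_neq n1); rewrite ?zx ?xy.
lia.
Qed.

(** A unit square in the coordinates [(k, l)]: over the bottom cell [(k, l)], the left entry is
    [(k - 1, l)], the right one [(k, l + 1)] and the top [(k - 1, l + 1)]. *)
Definition diamond_cells (d : quad u) : Prop :=
  [/\ label (top d) = label (bottom d) /\ k (bottom d) = (k (top d)).+1,
      (label (left_entry d)).+1 = label (bottom d) :> nat /\ k (left_entry d) = k (top d)
    & label (right_entry d) = (label (bottom d)).+1 :> nat
      /\ k (right_entry d) = k (bottom d)].

Lemma minimal_diamondP (d : quad u) : minimal_diamond d <-> diamond_cells d.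
Proof.
case: d => [[[b l] r] t]; rewrite /minimal_diamond /diamond_cells /= /bottom /top.
rewrite /left_entry /right_entry /= minimal_pairE !ord.
split=> [/and5P[/andP[/eqP bt /eqP kt] /eqP lb /eqP rb]|[[bt kt] [lb kl] [rb kr]]].
  rewrite kt -bt -lb rb => /andP[/and3P[_ ? ?] /and3P[_ ? ?]].
  by move=> /andP[/and3P[_ ? ?] /and3P[_ ? ?]]; split=> //; split=> //; lia.
have n1 : b != l by apply/eqP => e; rewrite e in lb; lia.
have n2 : l != t by apply/eqP => e; rewrite e bt in lb; lia.
have n3 : b != r by apply/eqP => e; rewrite e in rb; lia.
have n4 : r != t by apply/eqP => e; rewrite e bt in rb; lia.
by rewrite n1 n2 n3 n4 bt kt kl kr kt -lb rb !eqxx /=; lia.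
Qed.

Lemma diamond_cells_inj (d d' : quad u) : diamond_cells d -> diamond_cells d' ->
  label (bottom d) = label (bottom d') :> nat -> k (bottom d) = k (bottom d') -> d = d'.
Proof.
case: d d' => [[[b l] r] t] [[[b' l'] r'] t']; rewrite /diamond_cells /= /bottom /top.
rewrite /left_entry /right_entry /= => -[[/(congr1 val) /= bt kt] [lb kl] [rb kr]].
move=> [[/(congr1 val) /= bt' kt'] [lb' kl'] [rb' kr']] e1 e2.
by congr (_, _, _, _); apply: cell_inj; lia.
Qed.

(** A diamond is recorded by its bottom cell. The top has the next smaller [k] in the same column,
    which raises the lower boundary by one. *)
Let lo' i := (lo i.+1).+1.
Let hi' i := hi i.+1.

Lemma diamond_staircase : staircase lo' hi'.
Proof.
have [los his h0] := st; split=> [p|p|]; rewrite /lo' /hi' ?ltnS //.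
by have := his 0; have := los 0; lia.
Qed.

Lemma diamond_range (d : quad u) : diamond_cells d ->
  0 < label (bottom d) /\ lo' (label (bottom d)).-1 <= k (bottom d) < hi' (label (bottom d)).-1.
Proof.
move=> [[bt kt] [lb _] _]; have := rng (bottom d); have := rng (top d).
rewrite bt kt /lo' /hi' -lb /=; lia.
Qed.

(** The left and right entries lie between the bottom and the top, so convexity supplies them. *)
Lemma diamond_surj i l : lo' i <= l < hi' i ->
  exists d : quad u, [/\ diamond_cells d, label (bottom d) = i.+1 :> nat & k (bottom d) = l].
Proof.
rewrite /lo' /hi' => il.
have cb : lo i.+1 <= l < hi i.+1 by lia.
have ct : lo i.+1 <= l.-1 < hi i.+1 by lia.
have [b [bi bl]] := surj cb; have [t [ti tl]] := surj ct.
have [|p [pi pl]] := surj (j := i) (l := l.-1).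
  by apply: (staircase_convex st cb ct); split; lia.
have [|r [ri rl]] := surj (j := i.+2) (l := l).
  by apply: (staircase_convex st cb ct); split; lia.
exists (b, p, r, t); rewrite /diamond_cells /bottom /top /left_entry /right_entry /=.
by split=> //; split; split=> //; try lia; apply/val_inj; rewrite /= ti.
Qed.

Lemma diamond_relP (d d' : quad u) : diamond_cells d -> diamond_cells d' ->
    (label (bottom d) = (label (bottom d')).+1 :> nat /\ k (bottom d) = (k (bottom d')).+1)
    \/ (label (bottom d') = (label (bottom d)).+1 :> nat /\ k (bottom d') = k (bottom d)) ->
  diamond_rel d d'.
Proof.
move=> dd dd' adj; apply/and4P; split; try by apply/minimal_diamondP.
  case: d d' dd dd' adj => [[[b l] r] t] [[[b' l'] r'] t']; rewrite /diamond_cells.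
  rewrite /share_edge /entries /= /bottom /top /left_entry /right_entry /=.
  move=> [[/(congr1 val) /= bt kt] [lb kl] [rb kr]].
  move=> [[/(congr1 val) /= bt' kt'] [lb' kl'] [rb' kr']] [[e1 e2]|[e1 e2]].
    (* Shared edge: from left entry to top in [d], from bottom to right entry in [d']. In the other
       case below it goes from right entry to top in [d] and from bottom to left entry in [d']. *)
    have e3 : l = b' by apply: cell_inj; lia.
    have e4 : t = r' by apply: cell_inj; lia.
    apply/exists_inP; exists l; first by rewrite !inE e3 !eqxx ?orbT.
    apply/exists_inP; exists t; first by rewrite !inE e4 !eqxx ?orbT.
    have lt : l != t by apply/eqP => e; rewrite e in lb; lia.
    apply/andP; split; first by rewrite ord lt; lia.
    apply/existsP => -[c]; rewrite !ord => /andP[/and3P[n1 ? ?] /and3P[n2 ? ?]].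
    by case: (cell_neq n1); case: (cell_neq n2); lia.
  have e3 : r = b' by apply: cell_inj; lia.
  have e4 : t = l' by apply: cell_inj; lia.
  apply/exists_inP; exists r; first by rewrite !inE e3 !eqxx ?orbT.
  apply/exists_inP; exists t; first by rewrite !inE e4 !eqxx ?orbT.
  have rt : r != t by apply/eqP => e; rewrite e in rb; lia.
  apply/andP; split; first by rewrite ord rt; lia.
  apply/existsP => -[c]; rewrite !ord => /andP[/and3P[n1 ? ?] /and3P[n2 ? ?]].
  by case: (cell_neq n1); case: (cell_neq n2); lia.
rewrite ord; apply/and3P; split; [|lia|lia].
by apply/eqP => e; rewrite e in adj; lia.
Qed.

Lemma diamond_connect (d d' : quad u) : diamond_cells d -> diamond_cells d' ->
    k (bottom d') <= k (bottom d) ->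
    label (bottom d) + k (bottom d') <= label (bottom d') + k (bottom d) ->
  connect (@diamond_rel n u) d d'.
Proof.
pose K d := k (bottom d); pose L (d : quad u) : nat := label (bottom d).
rewrite -/(K d) -/(K d') -/(L d) -/(L d') => dd dd'.
have [N] := ubnP (K d - K d' + ((L d' + K d) - (L d + K d'))).
elim: N d dd => // N IHN d dd lt kk ll.
have st' := diamond_staircase.
have [L0 cd] := diamond_range dd; have [L0' cd'] := diamond_range dd'.
rewrite -/(L d) -/(L d') -/(K d) -/(K d') in L0 cd L0' cd'.
have go c : diamond_cells c -> diamond_rel d c -> K d' <= K c -> L c + K d' <= L d' + K c ->
    K c - K d' + ((L d' + K c) - (L c + K d')) < N -> connect (@diamond_rel n u) d d'.
  by move=> dc rc k1 l1 ltc; apply: connect_trans (connect1 rc) _; apply: IHN.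
have [kd|kd] := ltnP (K d') (K d).
  (* Lowering [k] moves one column to the left; from the first column of diamonds this would leave
     the region, contrary to [staircase_convex_left]. *)
  have [L1|L1] := leqP (L d) 1.
    by case: (staircase_convex_left (d := 0) (k := (K d).-1) st' cd cd'); lia.
  have [|c [dc cL cK]] := diamond_surj (i := (L d).-2) (l := (K d).-1).
    by apply: (staircase_convex st' cd cd'); split; lia.
  rewrite -/(L c) -/(K c) in cL cK.
  by apply: (go c dc); [apply: diamond_relP dd dc _; left; rewrite -/(L c) -/(L d) -/(K c) -/(K d)| | |]; lia.
have [ld|ld] := ltnP (L d) (L d'); last first.
  by rewrite (_ : d = d') //; apply: diamond_cells_inj; rewrite // -/(L d) -/(L d') -/(K d) -/(K d'); lia.
have [|c [dc cL cK]] := diamond_surj (i := L d) (l := K d).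
  by apply: (staircase_convex st' cd cd'); split; lia.
rewrite -/(L c) -/(K c) in cL cK.
by apply: (go c dc); [apply: diamond_relP dd dc _; right; rewrite -/(L c) -/(L d) -/(K c) -/(K d)| | |]; lia.
Qed.

Lemma connect_diamond_le (d d' : quad u) : connect (@diamond_rel n u) d d' ->
  k (bottom d') <= k (bottom d) /\
  label (bottom d) + k (bottom d') <= label (bottom d') + k (bottom d).
Proof.
move=> /connectP[p pth ->]; elim: p d pth => //= c p IHp d /andP[/and4P[_ _ _]].
by rewrite ord => /and3P[_ h1 h2] /IHp; lia.
Qed.

End Diamonds.

Lemma reduction_cell_model m (u : seq 'I_m.+2) (v : seq 'I_m) (phi : heap v -> quad u) lo hi :
    staircase lo hi -> cell_model u lo hi -> injective phi ->
    (forall d, minimal_diamond d <-> exists a, d = phi a) ->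
    (forall a, label (bottom (phi a)) = (label a).+1 :> nat) ->
    (forall a b, heap_lt a b = diamond_lt (phi a) (phi b)) ->
  cell_model v (fun i => (lo i.+1).+1) (fun i => hi i.+1).
Proof.
move=> st [k [rng inj surj ord]] phi_inj phi_surj phi_label phi_ord.
have dia a : diamond_cells k (phi a).
  by apply/(minimal_diamondP rng inj surj ord)/phi_surj; exists a.
exists (fun a => k (bottom (phi a))); split=> [a|a b la ka|j l jl|a b].
- by have [_] := diamond_range rng (dia a); rewrite phi_label.
- apply/phi_inj/(diamond_cells_inj inj) => //; by rewrite !phi_label la.
- have [d [dd dl dk]] := diamond_surj st surj jl.
  have /phi_surj [a dE] : minimal_diamond d by apply/(minimal_diamondP rng inj surj ord).
  by exists a; rewrite -dE; split=> //; apply/succn_inj; rewrite -phi_label -dE.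
rewrite phi_ord /diamond_lt (inj_eq phi_inj); congr andb.
have lE : (k (bottom (phi b)) <= k (bottom (phi a))) &&
    (label a + k (bottom (phi b)) <= label b + k (bottom (phi a))) =
    (k (bottom (phi b)) <= k (bottom (phi a))) &&
    (label (bottom (phi a)) + k (bottom (phi b)) <= label (bottom (phi b)) + k (bottom (phi a))).
  by rewrite !phi_label !addSn ltnS.
rewrite lE; apply/idP/andP => [/(connect_diamond_le ord) //|[h1 h2]].
exact: (diamond_connect st rng inj surj ord).
Qed.

(** * The diamond reduction avoids 321 *)

(** Take two consecutive moves of the strand [y] in opposite directions. The strand rests in
    between, so both letters have the same label, and no letter between them touches its position:
    this excludes that label and one neighboring label. *)
Lemma opposite_moves n (v : seq 'I_n) (y : 'I_n.+1) (a c : heap v) : a < c ->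
    (strand v a y = label a :> nat /\ strand v c y = (label c).+1 :> nat) \/
    (strand v a y = (label a).+1 :> nat /\ strand v c y = label c :> nat) ->
  exists a' c' : heap v, [/\ a' < c', label a' = label c' &
    (forall b : heap v, a' < b < c' -> label b <> label a' :> nat /\ label b <> (label a').+1 :> nat) \/
    (forall b : heap v, a' < b < c' -> label b <> label a' :> nat /\ label a' <> (label b).+1 :> nat)].
Proof.
have [d] := ubnP (c - a); elim: d a c => // d IHd a c lt ac opp.
have [[b [ab bc mv]]|no] := pselect (exists b : heap v, [/\ a < b, b < c &
    strand v b y = label b :> nat \/ strand v b y = (label b).+1 :> nat]).
  have [up_dn|same] := pselect ((strand v a y = label a :> nat /\ strand v b y = (label b).+1 :> nat) \/
    (strand v a y = (label a).+1 :> nat /\ strand v b y = label b :> nat)).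
    by apply: (IHd a b) => //; lia.
  by apply: (IHd b c) => //; [lia|]; case: opp mv same; intuition.
have const t : a < t <= c -> strand v t y = strand v a.+1 y.
  elim: t => // t IHt /andP[at_ tc]; have [e|ne] := eqVneq (a : nat) t; first by rewrite -e.
  have tv : t < size v := ltn_trans tc (ltn_ord c).
  have <- : strand v t y = strand v a.+1 y by apply: IHt; lia.
  rewrite -[t.+1]/(Ordinal tv).+1 strandS; apply/val_inj; rewrite /= gen_val /=.
  have ln : strand v t y <> label (Ordinal tv) :> nat /\
            strand v t y <> (label (Ordinal tv)).+1 :> nat.
    by split=> e; apply: no; exists (Ordinal tv); split=> //=; [lia|left|lia|right].
  by case: ifP => [/eqP|_]; [|case: ifP => [/eqP|_]]; tauto.
exists a, c; split=> //.
  have := const c; rewrite ac leqnn => /(_ isT) /(congr1 val); rewrite /= strandS gen_val => e.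
  apply/val_inj => /=; move: e; case: opp => -[-> ->]; rewrite eqxx.
    by case.
  by case: ifP; lia.
have stay (b : heap v) : a < b < c -> label b <> strand v a.+1 y :> nat /\
    (label b).+1 <> strand v a.+1 y :> nat.
  move=> /andP[ab bc]; rewrite -(const b); last by rewrite ab ltnW.
  by split=> e; apply: no; exists b; split=> //; [left|right].
case: opp => -[ea ec]; [left|right] => b /stay; rewrite strandS gen_val ea.
  by rewrite eqxx; lia.
by case: ifP; rewrite ?eqxx; lia.
Qed.

(** The middle strand of a 321 pattern moves down across [x] and up across [z]. Then
    [opposite_moves] gives two entries of one column with a neighboring column empty between them,
    whereas a staircase region has a cell between them in both neighboring columns. *)
Lemma cell_model_avoids321 n (v : seq 'I_n) (g : 'S_n.+1) lo hi : reduced_expr g v ->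
  staircase lo hi -> cell_model v lo hi -> avoids321 g.
Proof.
move=> rv st [k [rng inj surj ord]] [x [y [z [xy yz gyx gzy]]]].
have := crossing_time (u := v) (leqnn _) xy; rewrite !strand_size (proj1 rv).
move=> /(_ gyx) [a [_ /andP[_ /eqP ya]]].
have := crossing_time (u := v) (leqnn _) yz; rewrite !strand_size (proj1 rv).
move=> /(_ gzy) [c [_ /andP[/eqP yc _]]].
have [a' [c' [ac lab no]]] : exists a' c' : heap v, [/\ a' < c', label a' = label c' &
    (forall b : heap v, a' < b < c' -> label b <> label a' :> nat /\ label b <> (label a').+1 :> nat) \/
    (forall b : heap v, a' < b < c' -> label b <> label a' :> nat /\ label a' <> (label b).+1 :> nat)].
  case: (ltngtP a c) => [ac|ca|/val_inj e]; last by move: ya; rewrite e yc => /n_Sn.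
    by apply: (opposite_moves (y := y) ac); right.
  by apply: (opposite_moves (y := y) ca); left.
have ne : a' != c' by rewrite -val_eqE /= ltn_eqF.
have kne : k c' <> k a' by move=> e; case/eqP: ne; apply: inj.
have kac : k c' < k a'.
  rewrite ltnNge; apply/negP => le.
  have /heap_lt_ltn : heap_lt c' a' by rewrite ord eq_sym ne lab le leq_add2l.
  by rewrite ltnNge ltnW.
have ca := rng a'; have cc := rng c'.
have mid j l : between (label a') (k a') j l (label c') (k c') ->
    (j != label a' :> nat) || (l != k a') && (l != k c') ->
    exists b : heap v, [/\ a' < b < c', label b = j :> nat & k b = l].
  move=> btw nab; have [|b [bj bl]] := surj j l; first exact: staircase_convex btw.
  have [kb b1 b2] := btw.
  exists b; split=> //; apply/andP; split; apply: heap_lt_ltn; rewrite ord.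
    apply/and3P; split; [|lia|lia]; apply/eqP => e; move: nab.
    by rewrite -bj -bl -e !eqxx.
  apply/and3P; split; [|lia|lia]; apply/eqP => e; move: nab.
  by rewrite -bj -bl e lab !eqxx !andbF.
have kE : k a' = (k c').+1.
  apply/eqP; rewrite eqn_leq kac andbT leqNgt; apply/negP => lt.
  have [||b [abc bl _]] := mid (label a') (k c').+1; [by split; rewrite ?lab; lia|lia|].
  by case: no => /(_ b abc) [].
case: no => no.
  have [||b [/no [_ n1] bl _]] := mid (label a').+1 (k a'); [by split; rewrite ?lab; lia|lia|].
  by rewrite bl in n1.
have [L0|L0] := posnP (label a').
  apply: (staircase_convex_left (d := 0) (k := k c') st ca cc); lia.
have [||b [/no [_ n1] bl _]] := mid (label a').-1 (k c'); [by split; rewrite ?lab; lia|lia|].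
by rewrite bl in n1; lia.
Qed.

(** The common region identifies the two heaps. This carries a model known for one reduced
    expression of a 321-avoiding permutation to all of them. *)
Lemma cell_model_transfer n (v v' : seq 'I_n) lo hi lo' hi' : cell_model v lo hi ->
  cell_model v' lo hi -> cell_model v lo' hi' -> cell_model v' lo' hi'.
Proof.
move=> [k [rng inj surj ord]] [k' [rng' inj' surj' ord']] [q [qrng qinj qsurj qord]].
have ex (a : heap v') : {b : heap v | label b = label a :> nat /\ k b = k' a}.
  exact/cid/surj/rng'.
pose t a := sval (ex a).
have tl a : label (t a) = label a by apply/val_inj; rewrite /t; case: (ex a) => b [].
have tk a : k (t a) = k' a by rewrite /t; case: (ex a) => b [].
have tinj a b : (t a == t b) = (a == b).
  apply/eqP/eqP => [e|-> //]; apply: inj'; first by rewrite -!tl e.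
  by rewrite -!tk e.
exists (fun a => q (t a)); split=> [a|a b la qa|j l jl|a b].
- by rewrite -tl.
- by apply/eqP; rewrite -tinj; apply/eqP/qinj; rewrite ?tl.
- have [b [bj bl]] := qsurj j l jl.
  have [a [al ak]] := surj' (label b) (k b) (rng b).
  exists a; split; first by rewrite al.
  rewrite -bl; congr q; apply: inj; [apply/val_inj|]; by rewrite ?tl ?tk.
rewrite ord' -tinj -!tl -!tk; have := ord (t a) (t b); rewrite qord => e.
by rewrite -e.
Qed.

(** * Heap containment *)

(** The relations of order three send neighbors to indices at distance at most one, and [f] is
    increasing. *)
Lemma coxeter_embedding_shift k n (f : 'I_k -> 'I_n) : coxeter_embedding f ->
  exists j0, forall i, f i = j0 + i :> nat.
Proof.
move=> [finj fm fmono]; case: k => [|k] in f finj fm fmono *; first by exists 0 => -[].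
exists (f ord0) => i; case: i => i; elim: i => [|i IHi] ik; first by rewrite addn0; congr (val (f _)); apply/val_inj.
have ik' : i < k.+1 by apply: ltnW.
pose a := Ordinal ik'; pose b := Ordinal ik; rewrite /= addnS -(IHi ik') -/a -/b.
have ab : f a < f b by apply: fmono.
have /gen_order3[_] : ((gen (f a) * gen (f b)) ^+ 3 = 1)%g.
  by apply/fm => //; apply/gen_order3 => /=; lia.
lia.
Qed.

Lemma shift_coxeter_embedding k n (f : 'I_k -> 'I_n) j0 :
  (forall i, f i = j0 + i :> nat) -> coxeter_embedding f.
Proof.
move=> fE; split=> [i j /(congr1 val)|m|i j ij]; last by rewrite !fE ltn_add2l.
  by rewrite /= !fE => /addnI/val_inj.
rewrite !inE => /orP[] /eqP-> i j; last by rewrite !gen_order3 !fE -!addnS !leq_add2l.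
by rewrite !gen_order2 !fE -!addnS !eqn_add2l.
Qed.

Lemma coxeter_embedding_near k n (f : 'I_k -> 'I_n) i j : coxeter_embedding f ->
  (gen (f i) * gen (f j) != gen (f j) * gen (f i))%g = (gen i * gen j != gen j * gen i)%g.
Proof.
by move=> /coxeter_embedding_shift [j0 fE]; rewrite !gen_noncomm !fE -!addnS !eqn_add2l.
Qed.

Section MapHeap.
Variables (k n : nat) (f : 'I_k -> 'I_n) (v : seq 'I_k).
Hypothesis cf : coxeter_embedding f.

Definition unmap (a : heap (map f v)) : heap v := cast_ord (size_map f v) a.
Definition remap (a : heap v) : heap (map f v) := cast_ord (esym (size_map f v)) a.

Lemma unmapK : cancel unmap remap.
Proof. exact: cast_ordK. Qed.

Lemma remapK : cancel remap unmap.
Proof. exact: cast_ordKV. Qed.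

Lemma label_map a : label a = f (label (unmap a)).
Proof.
rewrite /label (tnth_nth (f (label (unmap a)))) (tnth_nth (label (unmap a))) /=.
by rewrite (nth_map (label (unmap a))) // -(size_map f v) ltn_ord.
Qed.

Lemma heap_rel_map a b : heap_rel a b = heap_rel (unmap a) (unmap b).
Proof. by rewrite /heap_rel !label_map coxeter_embedding_near. Qed.

Lemma connect_homo (T T' : finType) (e : rel T) (e' : rel T') (g : T -> T') x y :
  (forall x y, e x y -> e' (g x) (g y)) -> connect e x y -> connect e' (g x) (g y).
Proof.
move=> eg /connectP[p pth ->]; elim: p x pth => //= z p IHp x /andP[xz /IHp].
by apply: connect_trans; apply/connect1/eg.
Qed.

Lemma heap_lt_map a b : heap_lt a b = heap_lt (unmap a) (unmap b).
Proof.
rewrite /heap_lt (inj_eq (can_inj unmapK)); congr andb; apply/idP/idP.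
  by apply: connect_homo => x y; rewrite heap_rel_map.
rewrite -{2}(unmapK a) -{2}(unmapK b); apply: connect_homo => x y.
by rewrite heap_rel_map !remapK.
Qed.

End MapHeap.

Section Containment.
Variables (n k : nat) (u : seq 'I_n) (v : seq 'I_k) (f : 'I_k -> 'I_n) (j0 : nat).
Variables (V E lo hi : nat -> nat).
Hypotheses (stu : staircase V E) (stv : staircase lo hi).
Hypotheses (mu : cell_model u V E) (mv : cell_model v lo hi).
Hypothesis fE : forall i, f i = j0 + i :> nat.

(** The cells of [v] are translated by [j0] columns and by [p - q] in the second coordinate; two
    offsets allow either sign. *)
Lemma fits_subposet p q :
    (forall i, i < k -> V (j0 + i) + q <= lo i + p /\ hi i + p <= E (j0 + i) + q) ->
  convex_labeled_subposet (map f v) u.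
Proof.
move=> fits; have cf := shift_coxeter_embedding fE.
have [K [rng inj surj ord]] := mu; have [l [qrng qinj qsurj qord]] := mv.
have cell (a : heap v) : V (j0 + label a) <= l a + p - q < E (j0 + label a) /\ q <= l a + p.
  by have := fits _ (ltn_ord (label a)); have := qrng a; lia.
have ex (a : heap v) : {b : heap u | label b = j0 + label a :> nat /\ K b = l a + p - q}.
  by apply/cid/surj; case: (cell a).
pose t a := sval (ex a).
have tl a : label (t a) = j0 + label a :> nat by rewrite /t; case: (ex a) => b [].
have tk a : K (t a) = l a + p - q by rewrite /t; case: (ex a) => b [].
have tinj a b : (t a == t b) = (a == b).
  apply/eqP/eqP => [e|-> //]; have := tl a; have := tk a; rewrite e tl tk => e1 e2.
  by apply: qinj; [apply/val_inj => /=|have := cell a; have := cell b]; lia.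
have tord a b : heap_lt (t a) (t b) = heap_lt a b.
  rewrite ord qord tinj !tl !tk; congr andb.
  by have := cell a; have := cell b => -[_ ?] [_ ?]; apply/idP/idP; lia.
exists (t \o @unmap k n f v); split=> [a b /eqP|a|a b|a b y] /=.
- by rewrite tinj (inj_eq (can_inj (@unmapK _ _ _ _))) => /eqP.
- by apply/val_inj; rewrite /= tl label_map fE.
- by rewrite tord heap_lt_map.
move: (unmap a) (unmap b) => {}a {}b; rewrite !ord !tl !tk.
move=> /and3P[_ k1 l1] /and3P[_ k2 l2].
have [[_ qa] [_ qb]] := (cell a, cell b).
have [ca cb] := (qrng a, qrng b).
(* An entry [y] to the left of column [j0] would be a point to the left of column 0 between two
   cells of the region of [v]. *)
have [jy|yj] := leqP j0 (label y); last first.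
  by case: (staircase_convex_left (d := j0 - (label y).+1) (k := K y + q - p) stv ca cb); lia.
have [|c [cl ck]] := qsurj (label y - j0) (K y + q - p).
  by apply: (staircase_convex stv ca cb); split; lia.
exists (remap f c); rewrite remapK; apply: inj; first by apply/val_inj; rewrite /= tl cl; lia.
by rewrite tk ck; lia.
Qed.

(** Convexity leaves no gaps between the images of neighboring cells, so [K] changes exactly as [l]
    does. All columns being nonempty, neighboring cells connect the whole region and [K - l] is
    constant; the first and last cells of each column then give the inequalities. *)
Lemma subposet_fits : 0 < k -> (forall i, i < k -> lo i < hi i) ->
    convex_labeled_subposet (map f v) u ->
  exists p q, forall i, i < k -> V (j0 + i) + q <= lo i + p /\ hi i + p <= E (j0 + i) + q.
Proof.
move=> k0 ne [phi [phi_inj phi_label phi_ord phi_convex]].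
have cf := shift_coxeter_embedding fE.
have [K [rng inj surj ord]] := mu; have [l [qrng qinj qsurj qord]] := mv.
pose t a := phi (remap f a).
have tl a : label (t a) = j0 + label a :> nat by rewrite phi_label label_map remapK fE.
have tord a b : heap_lt (t a) (t b) = heap_lt a b by rewrite phi_ord heap_lt_map // !remapK.
have tconv a b y : heap_lt (t a) y -> heap_lt y (t b) -> exists c, y = t c.
  by move=> ay yb; have [c ->] := phi_convex _ _ _ ay yb; exists (unmap c); rewrite /t unmapK.
have qne (a b : heap v) : a != b -> label a <> label b :> nat \/ l a <> l b.
  by apply: cell_neq qinj a b.
(* Covers of the heap of v are mapped to covers of the heap of u. *)
have cover a b j i : heap_lt a b ->
    V j <= i < E j -> between (label (t a)) (K (t a)) j i (label (t b)) (K (t b)) ->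
    (j, i) <> (label (t a) : nat, K (t a)) -> (j, i) <> (label (t b) : nat, K (t b)) ->
    exists c, [/\ heap_lt a c, heap_lt c b & label (t c) = j :> nat].
  move=> ab cy [bt1 bt2 bt3] na nb; have [y [yj yi]] := surj j i cy.
  have ay : heap_lt (t a) y.
    rewrite ord yj yi; apply/and3P; split; [|lia|lia].
    by apply/eqP => e; apply: na; rewrite e yj yi.
  have yb : heap_lt y (t b).
    rewrite ord yj yi; apply/and3P; split; [|lia|lia].
    by apply/eqP => e; apply: nb; rewrite -e yj yi.
  have [c yc] := tconv _ _ _ ay yb; exists c.
  by rewrite yc !tord in ay yb; rewrite -yc.
have mono a b : heap_lt a b ->
    K (t b) <= K (t a) /\ label (t a) + K (t b) <= label (t b) + K (t a).
  by rewrite -tord ord => /and3P[].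
have step_up a b : label b = (label a).+1 :> nat -> l b = l a -> K (t b) = K (t a).
  move=> ba lab; have ab : heap_lt a b.
    by rewrite qord; apply/and3P; split; [apply/eqP => e; rewrite e in ba; lia|lia|lia].
  have [m1 m2] := mono a b ab; rewrite !tl in m2.
  apply/eqP; rewrite eqn_leq m1 leqNgt; apply/negP => lt.
  have btw : between (label (t a)) (K (t a)) (label (t a)) (K (t a)).-1 (label (t b)) (K (t b)).
    by split; rewrite ?tl; lia.
  have [||c [ac cb cl]] := cover a b _ _ ab (staircase_convex stu (rng (t a)) (rng (t b)) btw) btw.
  - by case; lia.
  - by case; rewrite !tl; lia.
  move: ac cb cl; rewrite !qord !tl => /and3P[nac ? ?] /and3P[ncb ? ?] ?.
  by case: (qne _ _ nac); lia.
have step_down a b : label a = (label b).+1 :> nat -> l a = (l b).+1 -> K (t a) = (K (t b)).+1.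
  move=> ba lab; have ab : heap_lt a b.
    by rewrite qord; apply/and3P; split; [apply/eqP => e; rewrite e in ba; lia|lia|lia].
  have [m1 m2] := mono a b ab; rewrite !tl in m2.
  apply/eqP; rewrite eqn_leq andbC; apply/andP; split; first lia.
  rewrite leqNgt; apply/negP => lt.
  have btw : between (label (t a)) (K (t a)) (label (t b)) (K (t b)).+1 (label (t b)) (K (t b)).
    by split; rewrite ?tl; lia.
  have [||c [ac cb cl]] := cover a b _ _ ab (staircase_convex stu (rng (t a)) (rng (t b)) btw) btw.
  - by case; rewrite !tl; lia.
  - by case; lia.
  move: ac cb cl; rewrite !qord !tl => /and3P[nac ? ?] /and3P[ncb ? ?] ?.
  by case: (qne _ _ ncb); lia.
have step_col a b : label a = label b :> nat -> l a = (l b).+1 -> K (t a) = (K (t b)).+1.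
  move=> ba lab; have ab : heap_lt a b.
    by rewrite qord; apply/and3P; split; [apply/eqP => e; rewrite e in lab; lia|lia|lia].
  have [m1 m2] := mono a b ab; rewrite !tl in m2.
  have ne_ab : K (t a) <> K (t b).
    move=> e; have : t a = t b by apply: inj => //; apply/val_inj; rewrite /= !tl ba.
    by move=> /phi_inj/(congr1 (@unmap _ _ _ _)); rewrite !remapK => e'; rewrite e' in lab; lia.
  apply/eqP; rewrite eqn_leq andbC; apply/andP; split; first lia.
  rewrite leqNgt; apply/negP => lt.
  have btw : between (label (t a)) (K (t a)) (label (t b)) (K (t b)).+1 (label (t b)) (K (t b)).
    by split; rewrite ?tl; lia.
  have [||c [ac cb cl]] := cover a b _ _ ab (staircase_convex stu (rng (t a)) (rng (t b)) btw) btw.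
  - by case; rewrite !tl; lia.
  - by case; lia.
  move: ac cb cl; rewrite !qord !tl => /and3P[nac ? ?] /and3P[ncb ? ?] ?.
  by case: (qne _ _ ncb); case: (qne _ _ nac); lia.
have [|a0 [a0j a0l]] := qsurj 0 (lo 0); first by rewrite leqnn ne.
(* Induction over the columns, and up each column. The lowest cells of consecutive columns are
   related by [step_up] or [step_down], according to whether [lo] stays or rises. *)
have shift i : i < k -> forall s a, label a = i :> nat -> l a = lo i + s ->
    K (t a) + l a0 = l a + K (t a0).
  elim: i => [|i IHi] ik; elim=> [|s IHs] a ai al.
  - have -> : a = a0 by apply: cell_inj qinj _ _ _ _; rewrite ?ai ?al ?addn0.
    by rewrite addnC.
  - have := qrng a; rewrite ai => ra.
    have [|b [bi bl]] := qsurj 0 (lo 0 + s); first by lia.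
    by have := IHs b bi bl; have := step_col a b; rewrite ai bi al bl addnS => /(_ erefl erefl); lia.
  - have [los _ _] := stv; have := los i; have := ne i (ltnW ik) => nei losi.
    have [|b [bi bl]] := qsurj i (lo i); first by lia.
    have := IHi (ltnW ik) 0 b bi; rewrite addn0 => /(_ bl).
    have [e|e] : lo i.+1 = lo i \/ lo i.+1 = (lo i).+1 by lia.
      by have := step_up b a; rewrite ai bi al bl => /(_ erefl); lia.
    by have := step_down a b; rewrite ai bi al bl => /(_ erefl); lia.
  - have := qrng a; rewrite ai => ra.
    have [|b [bi bl]] := qsurj i.+1 (lo i.+1 + s); first by lia.
    by have := IHs b bi bl; have := step_col a b; rewrite ai bi al bl addnS => /(_ erefl erefl); lia.
exists (K (t a0)), (l a0) => i ik; have nei := ne i ik.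
split.
  have [|a [ai al]] := qsurj i (lo i); first by lia.
  have := shift i ik 0 a ai; rewrite addn0 => /(_ al).
  by have := rng (t a); rewrite tl ai; lia.
have [|a [ai al]] := qsurj i (hi i).-1; first by lia.
have := shift i ik ((hi i).-1 - lo i) a ai; rewrite subnKC; last lia.
by move=> /(_ al); have := rng (t a); rewrite tl ai; lia.
Qed.

End Containment.

Lemma heap_containsP n k (w : 'S_n.+1) (q : 'S_k.+1) lo hi : avoids321 w -> 0 < k ->
    staircase lo hi -> (forall i, i < k -> lo i < hi i) ->
    (forall v, reduced_expr q v -> cell_model v lo hi) ->
  heap_contains w q <-> exists j0 p r, j0 + k <= n /\
    forall i, i < k -> lo_of w (j0 + i) + r <= lo i + p /\ hi i + p <= hi_of w (j0 + i) + r.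
Proof.
move=> av k0 st ne models; split=> [[u [v [f [ru rv cf sub]]]]|[j0 [p [r [jk fits]]]]].
  have [j0 fE] := coxeter_embedding_shift cf.
  have [p [r fits]] := subposet_fits (staircase_of w) st (avoider_cell_model av ru)
    (models v rv) fE k0 ne sub.
  exists j0, p, r; split=> //.
  have k1 : k.-1 < k by rewrite prednK.
  by have := ltn_ord (f (Ordinal k1)); rewrite fE /=; lia.
have [u ru] := reduced_exists w; have [v rv] := reduced_exists q.
have fn (i : 'I_k) : j0 + i < n by apply: leq_trans jk; rewrite ltn_add2l.
pose f i := Ordinal (fn i); have fE i : f i = j0 + i :> nat by [].
exists u, v, f; split=> //; first exact: shift_coxeter_embedding fE.
by apply: (fits_subposet st (avoider_cell_model av ru) (models v rv) fE fits).
Qed.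

(** * Motzkin words *)

(* (true, false) is an up step, (false, true) a down step, and the two other
   letters are the two colors of level steps. *)
Local Notation letter := (bool * bool)%type.
Local Notation word := (seq (bool * bool)).
Local Notation U := (true, false).
Local Notation D := (false, true).

(* The flag z allows the level steps (false, false) at height 0. *)
Fixpoint motzkin (z : bool) (h : nat) (s : word) : bool :=
  match s with
  | [::] => h == 0
  | x :: s' => (if x.1 then true else if x.2 then 0 < h else z || (0 < h))
               && motzkin z (h + x.1 - x.2) s'
  end.

Definition ups (s : word) p := count fst (take p s).
Definition downs (s : word) p := count snd (take p s).

Lemma ups0 s : ups s 0 = 0. Proof. by rewrite /ups take0. Qed.
Lemma downs0 s : downs s 0 = 0. Proof. by rewrite /downs take0. Qed.
Lemma ups_cons x s p : ups (x :: s) p.+1 = x.1 + ups s p. Proof. by []. Qed.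
Lemma downs_cons x s p : downs (x :: s) p.+1 = x.2 + downs s p. Proof. by []. Qed.

Lemma motzkinP z h s : motzkin z h s <->
  [/\ forall p, downs s p <= h + ups s p, downs s (size s) = h + ups s (size s)
    & forall p, p < size s -> nth U s p = (false, false) -> z \/ downs s p < h + ups s p].
Proof.
elim: s h => [|[e d] s IHs] h /=.
  split=> [/eqP->|[_]]; first by split=> // p; rewrite /ups /downs.
  by rewrite ups0 downs0 addn0 => <-.
split=> [/andP[step /IHs [le eq_ lt]]|[le eq_ lt]].
  have h1 : d <= h + e by move: step; case: (e); case: (d) => //=; lia.
  split=> [[|p]||[|p]]; rewrite ?ups0 ?downs0 ?ups_cons ?downs_cons //=.
  - by have := le p; lia.
  - by move: eq_; lia.
  - by move=> _ [e0 d0]; move: step; rewrite e0 d0 /= addn0 => /orP[]; [left|right].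
  - by move=> ps /(lt p ps) [|l]; [left|right; lia].
have h1 : d <= h + e by have := le 1; rewrite ups_cons downs_cons ups0 downs0 /=; lia.
apply/andP; split.
  have := lt 0 isT; rewrite ups0 downs0 /=; move: h1.
  case: (e) => //; case: (d) => /=; first by lia.
  by move=> _ /(_ erefl) [->|] //; rewrite addn0 orbC => ->.
apply/IHs; split=> [p||p ps pl].
- by have := le p.+1; rewrite ups_cons downs_cons /=; lia.
- by move: eq_; rewrite ups_cons downs_cons /=; lia.
- have [|l] := lt p.+1 ps pl; first by left.
  by right; move: l; rewrite ups_cons downs_cons /=; lia.
Qed.

Lemma ups_over s p : size s <= p -> ups s p = ups s (size s).
Proof. by move=> sp; rewrite /ups take_oversize // take_size. Qed.

Lemma downs_over s p : size s <= p -> downs s p = downs s (size s).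
Proof. by move=> sp; rewrite /downs take_oversize // take_size. Qed.

Lemma ups_catl s t p : p <= size s -> ups (s ++ t) p = ups s p.
Proof. by move=> ps; rewrite /ups takel_cat. Qed.

Lemma downs_catl s t p : p <= size s -> downs (s ++ t) p = downs s p.
Proof. by move=> ps; rewrite /downs takel_cat. Qed.

Lemma ups_catr s t p : ups (s ++ t) (size s + p) = ups s (size s) + ups t p.
Proof.
rewrite /ups take_cat ltnNge leq_addr /= addKn count_cat take_size.
by [].
Qed.

Lemma downs_catr s t p : downs (s ++ t) (size s + p) = downs s (size s) + downs t p.
Proof. by rewrite /downs take_cat ltnNge leq_addr /= addKn count_cat take_size. Qed.

Definition balanced s := ups s (size s) = downs s (size s).

Lemma motzkin_balanced z s : motzkin z 0 s -> balanced s.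
Proof. by move=> /motzkinP[_ e _]; rewrite /balanced e. Qed.

Lemma balanced_over s p : balanced s -> size s <= p -> ups s p = downs s p.
Proof. by move=> b sp; rewrite ups_over // downs_over. Qed.

(** * 321-avoiding permutations as Motzkin words *)

Definition word_of n (w : 'S_n.+1) : word := [seq (exc w x, excv w x) | x <- enum 'I_n.+1].

Lemma size_word_of n (w : 'S_n.+1) : size (word_of w) = n.+1.
Proof. by rewrite size_map size_enum_ord. Qed.

Lemma rank_count N (P : pred 'I_N) p : rank P p = count P (take p (enum 'I_N)).
Proof.
elim: p => [|p IHp]; first by rewrite take0 rank0.
case: (ltnP p N) => pN; last first.
  rewrite rank_over ?(leqW pN) // -(rank_over P pN) IHp !take_oversize ?size_enum_ord //.
  exact: leqW.
rewrite (take_nth (Ordinal pN)) ?size_enum_ord // -cats1 count_cat /= addn0 -IHp.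
by rewrite (rankS P (Ordinal pN)) [nth _ _ p](nth_ord_enum _ (Ordinal pN)).
Qed.

Lemma ups_word_of n (w : 'S_n.+1) p : ups (word_of w) p = rank (exc w) p.
Proof. by rewrite rank_count /ups -map_take count_map. Qed.

Lemma downs_word_of n (w : 'S_n.+1) p : downs (word_of w) p = rank (excv w) p.
Proof. by rewrite rank_count /downs -map_take count_map. Qed.

Lemma nth_word_of n (w : 'S_n.+1) (x : 'I_n.+1) l : nth l (word_of w) x = (exc w x, excv w x).
Proof. by rewrite (nth_map x) ?size_enum_ord // nth_ord_enum. Qed.

(** [w] lowers every non-exceedance, so it maps those up to [p] injectively to values below [p]. *)
Lemma rank_nexc_le n (w : 'S_n.+1) p :
  rank (predC (exc w)) p.+1 <= rank (predC (excv w)) p.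
Proof.
rewrite /rank -(card_imset _ (@perm_inj _ w)); apply/subset_leq_card/subsetP => _ /imsetP[x xin ->].
move: xin; rewrite !inE /= /exc /excv permK -!ltnNge => /andP[xp wx].
by rewrite wx andbT; lia.
Qed.

Lemma word_of_motzkin n (w : 'S_n.+1) : avoids321 w -> motzkin false 0 (word_of w).
Proof.
move=> av; apply/motzkinP; split=> [p||p].
- rewrite ups_word_of downs_word_of add0n.
  case: (leqP p n.+1) => pn; last by rewrite rank_exc_over // ltnW.
  have := rank_nexc_le w p; have := rankC (exc w) pn; have := rankC (excv w) pn.
  by have := rank_step (predC (exc w)) p; lia.
- by rewrite size_word_of ups_word_of downs_word_of rank_exc_total.
rewrite size_word_of => pn; rewrite -[p]/(val (Ordinal pn)) nth_word_of => -[ep _].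
right; rewrite ups_word_of downs_word_of add0n.
have := rank_nexc_le w p; have := rankC (exc w) (ltnW pn); have := rankC (excv w) (ltnW pn).
by rewrite (rankS _ (Ordinal pn)) /= ep /=; lia.
Qed.

(** The word determines the positions and values of both classes, and a 321-avoiding permutation is
    increasing on each class. *)
Lemma word_of_inj n (w w' : 'S_n.+1) : avoids321 w -> avoids321 w' ->
  word_of w = word_of w' -> w = w'.
Proof.
move=> av av' e.
have eq x : exc w x = exc w' x /\ excv w x = excv w' x.
  by have := congr1 (fun s => nth U s x) e; rewrite !nth_word_of => -[].
have rE p : rank (exc w) p = rank (exc w') p.
  by apply: eq_card => x; rewrite !inE (eq x).1.
have rV p : rank (excv w) p = rank (excv w') p.
  by apply: eq_card => x; rewrite !inE (eq x).2.
have rcE p : rank (predC (exc w)) p = rank (predC (exc w')) p.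
  by apply: eq_card => x; rewrite !inE /= (eq x).1.
have rcV p : rank (predC (excv w)) p = rank (predC (excv w')) p.
  by apply: eq_card => x; rewrite !inE /= (eq x).2.
apply/permP => x; have [ex|ex] := boolP (exc w x).
  apply: (rank_inj (P := excv w)); first by rewrite /excv permK.
    by rewrite (eq _).2 /excv permK -/(exc w' x) -(eq x).1.
  by rewrite rank_exc // rV rank_exc ?rE // -(eq x).1.
apply: (rank_inj (P := predC (excv w))); first by rewrite /= /excv permK.
  by rewrite /= (eq _).2 /excv permK -/(exc w' x) -(eq x).1.
by rewrite rank_nexc // rcV rank_nexc ?rcE // -(eq x).1.
Qed.

Lemma word_of_surj n s : size s = n.+1 -> motzkin false 0 s ->
  exists2 w : 'S_n.+1, avoids321 w & word_of w = s.
Proof.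
move=> sz /motzkinP[le tot lev].
pose P (x : 'I_n.+1) := (nth U s x).1; pose Q (x : 'I_n.+1) := (nth U s x).2.
have sE : s = [seq (P x, Q x) | x <- enum 'I_n.+1].
  apply: (@eq_from_nth _ U); first by rewrite size_map size_enum_ord.
  move=> i; rewrite sz => lt_i; rewrite (nth_map (Ordinal lt_i)) ?size_enum_ord //.
  by rewrite [nth _ (enum _) i](nth_ord_enum _ (Ordinal lt_i)) -surjective_pairing.
have upE p : ups s p = rank P p by rewrite rank_count {1}sE /ups -map_take count_map.
have dnE p : downs s p = rank Q p by rewrite rank_count {1}sE /downs -map_take count_map.
have leQP p : rank Q p <= rank P p by rewrite -upE -dnE -[X in _ <= X]add0n.
have totQP : rank Q n.+1 = rank P n.+1 by rewrite -upE -dnE -sz tot.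
have totC : rank (predC Q) n.+1 = rank (predC P) n.+1.
  by have := rankC P (leqnn n.+1); have := rankC Q (leqnn n.+1); lia.
have lt_tot (R : pred 'I_n.+1) (x : 'I_n.+1) : R x -> rank R x < rank R n.+1.
  by move=> Rx; have := rank_le R (ltn_ord x); rewrite rankS Rx; lia.
(* The permutation matches positions with values of the same class and the same rank. *)
have ex (x : 'I_n.+1) : {y : 'I_n.+1 | Q y = P x /\
    if P x then rank Q y = rank P x else rank (predC Q) y = rank (predC P) x}.
  apply: cid; case: (boolP (P x)) => Px.
    by have [|y [_ Qy yr]] := @rank_ivt _ Q n.+1 (rank P x); [rewrite totQP|exists y]; auto.
  have [|y [_ Qy yr]] := @rank_ivt _ (predC Q) n.+1 (rank (predC P) x).
    by rewrite totC; apply: lt_tot.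
  by exists y; split=> //; apply/negbTE.
pose f x := sval (ex x).
have fQ x : Q (f x) = P x by rewrite /f; case: (ex x) => y [].
have fr x : P x -> rank Q (f x) = rank P x.
  by move=> Px; rewrite /f; case: (ex x) => y /= []; rewrite Px.
have frC x : ~~ P x -> rank (predC Q) (f x) = rank (predC P) x.
  by move=> /negbTE Px; rewrite /f; case: (ex x) => y /= []; rewrite Px.
have mono x y : P x = P y -> x < y -> f x < f y.
  move=> e xy; case: (boolP (P x)) => Px.
    have Py : P y by rewrite -e.
    by rewrite -(rank_ltP (P := Q)) ?fQ // !fr // rank_ltP.
  have Py : ~~ P y by rewrite -e.
  by rewrite -(rank_ltP (P := predC Q)) /= ?fQ // !frC // rank_ltP.
have finj : injective f.
  move=> x y fxy; have e : P x = P y by rewrite -!fQ fxy.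
  apply/val_inj => /=; case: (ltngtP x y) => // l.
    by have := mono x y e l; rewrite fxy ltnn.
  by have := mono y x (esym e) l; rewrite fxy ltnn.
pose w := perm finj.
have excE x : exc w x = P x.
  rewrite /exc permE; case: (boolP (P x)) => Px.
    rewrite leqNgt; apply/negP => lt.
    have := rank_le Q lt; rewrite rankS fQ Px (fr _ Px); have := leQP x; lia.
  (* If [x <= f x], the height before [x] is 0. A down step is impossible there by [leQP], and the
     letter [(false, false)] by [lev]. *)
  apply/negbTE; rewrite -ltnNge ltnNge; apply/negP => xf.
  have := rank_le (predC Q) xf; rewrite (frC _ Px).
  have := rankC P (ltnW (ltn_ord x)); have := rankC Q (ltnW (ltn_ord x)).
  have := leQP x; have := leQP x.+1; rewrite !rankS (negbTE Px).
  case: (boolP (Q x)) => Qx; first by lia.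
  have nx : nth U s x = (false, false).
    by rewrite [LHS]surjective_pairing -/(P x) -/(Q x) (negbTE Px) (negbTE Qx).
  by have [|//|] := lev x _ nx; rewrite ?sz ?upE ?dnE //; lia.
exists w.
  move=> [i [j [k [ij jk]]]]; rewrite !permE => ji kj.
  (* Two of the three points of a 321 pattern belong to one class, on which [w] is increasing. *)
  case: (boolP (P i == P j)) => [/eqP e|ne]; first by have := mono i j e ij; lia.
  case: (boolP (P j == P k)) => [/eqP e|ne']; first by have := mono j k e jk; lia.
  have e : P i = P k by move: ne ne'; case: (P i) (P j) (P k) => -[] [].
  by have := mono i k e (ltn_trans ij jk); lia.
rewrite sE; apply: eq_map => x; rewrite excE; congr pair.
by rewrite -[x in LHS](permKV w) /excv permK -/(exc w _) excE -fQ -permE -/w permKV.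
Qed.

(** * Occurrences of a staircase in a word *)

Lemma motzkin_excursion z s : motzkin true 0 s -> motzkin z 0 (U :: s ++ [:: D]).
Proof.
move=> /motzkinP[le tot _]; apply/motzkinP.
have bs : ups s (size s) = downs s (size s) by lia.
have prefix p : [\/ p = 0, exists2 q, p = q.+1 & q <= size s /\
    ups (U :: s ++ [:: D]) p = (ups s q).+1 /\ downs (U :: s ++ [:: D]) p = downs s q
    | (size s).+1 < p /\ ups (U :: s ++ [:: D]) p = (ups s (size s)).+1
      /\ downs (U :: s ++ [:: D]) p = (ups s (size s)).+1].
  case: p => [|p]; [by constructor 1|case: (leqP p (size s)) => ps].
    by constructor 2; exists p => //; rewrite ups_cons downs_cons ups_catl // downs_catl.
  constructor 3; split=> //; rewrite ups_cons downs_cons.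
  have -> : p = size s + (p - (size s).+1).+1 by lia.
  by rewrite ups_catr downs_catr -bs ups_cons downs_cons /= addn0 addn1.
split=> [p||p].
- by case: (prefix p) => [->|[q _ [_ [-> ->]]]|[_ [-> ->]]] //; have := le q; lia.
- by rewrite /= size_cat addn1; case: (prefix (size s).+2) => [//|[q [<-]]|[_ [-> ->]]//]; lia.
rewrite /= size_cat addn1 => pl lev; right.
case: (prefix p) => [p0|[q -> [_ [-> ->]]]|]; [by rewrite p0 in lev|by have := le q; lia|lia].
Qed.

Section Occurrence.
Variables (m : nat) (lo hi : nat -> nat).
Hypothesis m_gt0 : 0 < m.
Hypothesis lo_lt_hi : forall i, i < m -> lo i < hi i.

(* Both boundaries of the region of s are translated by (a, p - r); the lower
   one is first raised by d. With d = 1 the region is that of the diamonds. *)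
Definition occurs (d : nat) (s : word) := exists a p r, forall i, i < m ->
  downs s (a + i) + d + r <= lo i + p /\ hi i + p <= ups s (a + i) + r.

Definition avoiding d s := ~~ `[< occurs d s >].

(** The columns of the pattern are nonempty, so an occurrence lies over heights greater than [d] and
    meets no return to height 0. *)
Lemma occurs_high d s a p r i : (forall i, i < m ->
    downs s (a + i) + d + r <= lo i + p /\ hi i + p <= ups s (a + i) + r) ->
  i < m -> downs s (a + i) + d < ups s (a + i).
Proof. by move=> occ im; have := occ i im; have := lo_lt_hi im; lia. Qed.

Lemma occurs_cat d s t : balanced s -> occurs d (s ++ t) <-> occurs d s \/ occurs d t.
Proof.
move=> bs; split=> [[a [p [r occ]]]|[[a [p [r occ]]]|[a [p [r occ]]]]].
- have [le|lt] := leqP (a + m) (size s).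
    left; exists a, p, r => i im; have := occ i im.
    by rewrite ups_catl ?downs_catl; lia.
  have [as_|as_] := leqP a (size s).
    (* An occurrence across the cut would cover the position [size s], of height 0. *)
    have im : size s - a < m by lia.
    have := occurs_high occ im; rewrite subnKC // ups_catl // downs_catl //.
    by have := bs; rewrite /balanced; lia.
  right; exists (a - size s), p, (r + ups s (size s)) => i im; have := occ i im.
  rewrite (_ : a + i = size s + (a - size s + i)); last by lia.
  by rewrite ups_catr downs_catr bs; lia.
- exists a, p, r => i im; have := occ i im; have := occurs_high occ im.
  (* [occurs] admits positions past the end of [s]; the height is 0 there. *)
  case: (leqP (a + i) (size s)) => [le|/ltnW/(balanced_over bs)]; last by lia.
  by rewrite ups_catl // downs_catl.
exists (size s + a), (p + ups s (size s)), r => i im; have := occ i im.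
by rewrite -(addnA (size s)) ups_catr downs_catr bs; lia.
Qed.

Lemma occurs_flat d s : (forall p, ups s p = downs s p) -> ~ occurs d s.
Proof. by move=> flat [a [p [r occ]]]; have := occurs_high occ m_gt0; rewrite flat; lia. Qed.

Lemma avoiding_nil d : avoiding d [::].
Proof. by apply/negP => /asboolP; apply: occurs_flat. Qed.

Lemma avoiding_cat d s t : balanced s -> avoiding d (s ++ t) = avoiding d s && avoiding d t.
Proof.
move=> bs; rewrite /avoiding -negb_or; congr negb.
apply/asboolP/orP => [/occurs_cat [//|occ|occ]|occ]; try by [left; apply/asboolP|right; apply/asboolP].
by apply/occurs_cat => //; case: occ => /asboolP; [left|right].
Qed.

Lemma avoiding_level d e s : avoiding d ((e, e) :: s) = avoiding d s.
Proof.
rewrite -cat1s avoiding_cat //.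
have -> // : avoiding d [:: (e, e)].
by apply/negP => /asboolP; apply: occurs_flat; case=> [|[|p]].
Qed.

Lemma avoiding_excursion d s t : motzkin true 0 s ->
  avoiding d (U :: s ++ D :: t) = avoiding d (U :: s ++ [:: D]) && avoiding d t.
Proof.
move=> ms; rewrite -avoiding_cat; first by rewrite /= -catA.
exact/motzkin_balanced/(motzkin_excursion true).
Qed.

(** The enclosing steps raise the path by one, which compensates for raising the lower boundary;
    occurrences move by one position. *)
Lemma avoiding_reduce s : motzkin true 0 s -> avoiding 1 (U :: s ++ [:: D]) = avoiding 0 s.
Proof.
move=> ms; have bs := motzkin_balanced ms.
congr negb; apply: asbool_equiv_eq; split=> -[a [p [r occ]]]; last first.
  exists a.+1, p.+1, r => i im; have := occ i im; have := occurs_high occ im.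
  rewrite addSn ups_cons downs_cons /=.
  case: (leqP (a + i) (size s)) => [le|/ltnW/(balanced_over bs)]; last by lia.
  by rewrite ups_catl // downs_catl; lia.
have bt := motzkin_balanced (motzkin_excursion true ms).
exists a.-1, p, r.+1 => i im; have := occ i im; have := occurs_high occ im.
case: a occ => [|a] occ.
  by have := occurs_high occ m_gt0; rewrite ups0.
rewrite addSn ups_cons downs_cons /=.
case: (leqP (a + i) (size s)) => [le|lt]; first by rewrite ups_catl // downs_catl; lia.
have := balanced_over bt (p := (a + i).+1) => /(_ _)/wrap[]; first by rewrite /= size_cat addn1.
by rewrite ups_cons downs_cons /=; lia.
Qed.

End Occurrence.

(** * Sums over words *)

Definition letters : word := [:: U; D; (true, true); (false, false)].

Fixpoint words N : seq word :=
  if N is N'.+1 then [seq x :: s | x <- letters, s <- words N'] else [:: [::]].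

Lemma wordsS N : words N.+1 = [seq x :: s | x <- letters, s <- words N].
Proof. by []. Qed.

Lemma mem_words N s : (s \in words N) = (size s == N).
Proof.
elim: N s => [|N IHN] s; first by rewrite inE; case: s.
rewrite wordsS; apply/allpairsP/idP => [[[y t] /= [_ ts ->]]|].
  by rewrite /= eqSS -IHN.
case: s => // x s; rewrite /= eqSS -IHN => ss; exists (x, s); split=> //.
by case: x => -[] [].
Qed.

Lemma words_uniq N : uniq (words N).
Proof. by elim: N => // N IHN; rewrite wordsS; apply: allpairs_uniq => // -[x s] [y t] _ _ [-> ->]. Qed.

Definition wsum N (F : word -> nat) := \sum_(s <- words N) F s.

Lemma wsumS N F : wsum N.+1 F = wsum N (fun s => F (U :: s)) + wsum N (fun s => F (D :: s))
  + wsum N (fun s => F ((true, true) :: s)) + wsum N (fun s => F ((false, false) :: s)).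
Proof.
rewrite /wsum wordsS big_allpairs_dep !big_cons big_nil /=; lia.
Qed.

Lemma wsum_cat i j F : wsum (i + j) F = wsum i (fun s => wsum j (fun t => F (s ++ t))).
Proof.
elim: i F => [|i IHi] F; first by rewrite /wsum big_seq1.
by rewrite addSn !wsumS !IHi.
Qed.

Lemma eq_wsum N F G : (forall s, size s = N -> F s = G s) -> wsum N F = wsum N G.
Proof. by move=> e; apply: eq_big_seq => s; rewrite mem_words => /eqP; apply: e. Qed.

Lemma wsum_mull N c F : wsum N (fun s => c * F s) = c * wsum N F.
Proof. by rewrite /wsum big_distrr. Qed.

Lemma wsum_mulr N c F : wsum N (fun s => F s * c) = wsum N F * c.
Proof. by rewrite /wsum big_distrl. Qed.

Lemma wsum_add N F G : wsum N (fun s => F s + G s) = wsum N F + wsum N G.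
Proof. exact: big_split. Qed.

Lemma wsum0 N F : (forall s, F s = 0) -> wsum N F = 0.
Proof. by move=> F0; apply: big1 => s _. Qed.

(* The word is cut at its first down step to height 0. *)
Lemma motzkin_first_return z h s : (motzkin z h.+1 s : nat) = \sum_(i < size s)
  motzkin true h (take i s) * (nth U s i == D) * motzkin z 0 (drop i.+1 s).
Proof.
elim: s h => [|[e d] s IHs] h /=; first by rewrite big_ord0.
rewrite big_ord_recl /= drop0.
under eq_bigr => i _ do rewrite /bump /= add1n add0n.
case: e; case: d => /=; rewrite ?addn1 ?addn0 ?subn0 ?subn1 ?addnK ?muln0 ?add0n ?orbT //=.
case: h => [|h] /=; last by rewrite !mul0n add0n IHs.
by rewrite mul1n mul1n big1 ?addn0 // => i _; rewrite !mul0n.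
Qed.

Section Recurrence.
Variable X : pred word.
Hypothesis X_level : forall e s, X ((e, e) :: s) = X s.
Hypothesis X_excursion : forall s t, motzkin true 0 s ->
  X (U :: s ++ D :: t) = X (U :: s ++ [:: D]) && X t.

Definition motzkin_count z N := wsum N (fun s => motzkin z 0 s && X s).
Definition excursion_count N :=
  wsum N (fun s => motzkin true 0 s && X (U :: s ++ [:: D])).

(** A word starts with one of the [z.+1] level steps allowed at height 0, or with an up step; in the
    latter case it is cut at its first return, and [X] splits by [X_excursion]. *)
Lemma motzkin_count_rec z N : motzkin_count z N.+1 = z.+1 * motzkin_count z N +
  \sum_(i < N) excursion_count i * motzkin_count z (N - i.+1).
Proof.
rewrite {1}/motzkin_count wsumS.
have -> : wsum N (fun s => motzkin z 0 (D :: s) && X (D :: s) : nat) = 0 by apply: wsum0.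
have -> : wsum N (fun s => motzkin z 0 ((true, true) :: s) && X ((true, true) :: s) : nat)
  = motzkin_count z N by apply: eq_wsum => s _; rewrite X_level.
have -> : wsum N (fun s => motzkin z 0 ((false, false) :: s) && X ((false, false) :: s) : nat)
  = z * motzkin_count z N.
  rewrite -wsum_mull; apply: eq_wsum => s _; rewrite X_level /= orbF.
  by case: (z); rewrite /= ?mul1n.
rewrite addn0 -addnA -mulSn addnC; congr (_ + _).
rewrite [LHS](_ : _ = wsum N (fun s => \sum_(i < N)
    (motzkin true 0 (take i s) && X (U :: take i s ++ [:: D])) * ((nth U s i == D) *
      (motzkin z 0 (drop i.+1 s) && X (drop i.+1 s))))); last first.
  apply: eq_wsum => s sN; rewrite -mulnb motzkin_first_return big_distrl sN /=.
  apply: eq_bigr => i _; case m1: (motzkin true 0 (take i s)); rewrite ?mul0n //.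
  case: eqP => [nD|]; rewrite ?muln0 // !mul1n.
  have -> : X (U :: s) = X (U :: take i s ++ [:: D]) && X (drop i.+1 s).
    by rewrite -X_excursion // -nD -drop_nth ?cat_take_drop // sN.
  by case: (motzkin z _ _); case: (X _); case: (X _).
rewrite /wsum exchange_big; apply: eq_bigr => i _ /=; rewrite -/(wsum _ _).
(* For a fixed place of the return, the sum factors over the inner word, the letter [D] and the
   rest. *)
case: i => i iN /=; have := subnSK iN; move: (N - i.+1) => j ij.
rewrite -(subnKC (ltnW iN)) -ij wsum_cat /excursion_count -wsum_mulr; apply: eq_wsum => s si.
set G := (fun t => _); have G0 x t : x != D -> G (x :: t) = 0.
  by move=> /negbTE xD; rewrite /G -si nth_cat ltnn subnn /= xD muln0.
rewrite wsumS (@wsum0 _ (fun t => G (U :: t))); last by move=> t; apply: G0.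
rewrite (@wsum0 _ (fun t => G ((true, true) :: t))); last by move=> t; apply: G0.
rewrite (@wsum0 _ (fun t => G ((false, false) :: t))); last by move=> t; apply: G0.
rewrite !addn0 add0n -wsum_mull; apply: eq_wsum => t _.
have dropE : drop (size s).+1 (s ++ D :: t) = t.
  by rewrite -cat_rcons drop_size_cat ?size_rcons.
by rewrite /G -si dropE take_size_cat // nth_cat ltnn subnn /= mul1n.
Qed.

End Recurrence.

(** * Counting avoiders *)

Lemma card_word_set n (A : {set 'S_n.+1}) (F : pred word) :
    (forall w, w \in A <-> avoids321 w /\ F (word_of w)) ->
  #|A| = wsum n.+1 (fun s => motzkin false 0 s && F s).
Proof.
move=> AP; rewrite cardE -(size_map (@word_of n)) /wsum.
rewrite (eq_bigr (fun s => if motzkin false 0 s && F s then 1 else 0)); last first.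
  by move=> s _; case: (_ && _).
rewrite -big_mkcond -big_filter sum1_size; apply/perm_size/uniq_perm.
- rewrite map_inj_in_uniq ?enum_uniq // => w w'; rewrite !mem_enum => /AP[av _] /AP[av' _].
  exact: word_of_inj.
- exact/filter_uniq/words_uniq.
move=> s; rewrite mem_filter mem_words; apply/mapP/andP => [[w]|].
  rewrite mem_enum => /AP[av Fw] ->; rewrite size_word_of eqxx; split=> //.
  by rewrite Fw word_of_motzkin.
move=> [/andP[mz Fs] /eqP sz]; have [w av wE] := word_of_surj sz mz.
by exists w; rewrite ?wE // mem_enum; apply/AP; rewrite wE.
Qed.

Lemma in_supp_cell n (w : 'S_n.+1) (i : 'I_n) : avoids321 w ->
  in_supp w i <-> lo_of w i < hi_of w i.
Proof.
move=> av; split=> [[u ru iu]|lt].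
  have [k [rng _ _ _]] := avoider_cell_model av ru.
  have iu' : index i u < size u by rewrite index_mem.
  have := rng (Ordinal iu'); rewrite /label (tnth_nth i) /= nth_index //; lia.
have [u ru] := reduced_exists w; exists u => //.
have [k [_ _ surj _]] := avoider_cell_model av ru.
have [|a [ai _]] := surj i (lo_of w i); first by rewrite leqnn lt.
by rewrite -(val_inj ai : label a = i) mem_tnth.
Qed.

Definition positive (s : word) := all (fun p => downs s p < ups s p) (iota 1 (size s).-1).

Lemma positiveP s : reflect (forall p, 0 < p < size s -> downs s p < ups s p) (positive s).
Proof.
apply: (iffP allP) => pos p; last by rewrite mem_iota => ?; apply: pos; lia.
by move=> ps; apply: pos; rewrite mem_iota; lia.
Qed.

Lemma connected_word n (w : 'S_n.+1) : avoids321 w ->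
  (connected w /\ full_support w) <-> 0 < n /\ positive (word_of w).
Proof.
move=> av; split=> [[[a _] full]|[n0 /positiveP pos]].
  split; first exact: leq_ltn_trans (ltn_ord a).
  apply/positiveP => -[//|p]; rewrite size_word_of /= => /ltnSE pn.
  rewrite ups_word_of downs_word_of; exact: (proj1 (in_supp_cell (Ordinal pn) av) (full _)).
have full : full_support w.
  move=> i; apply/in_supp_cell => //; have := pos i.+1.
  by rewrite size_word_of ups_word_of downs_word_of /= => /(_ (ltn_ord i)).
split=> //; have n1 : n.-1 < n by rewrite prednK.
exists (Ordinal n0), (Ordinal n1); split=> // c; split=> // _ /=.
by have := ltn_ord c; lia.
Qed.

(** Positive height inside forces the two outer steps. The inner word starts at actual height 1, so
    both level steps are allowed throughout, whence the flag [true]. *)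
Lemma positive_motzkin x s y : motzkin false 0 (x :: s ++ [:: y]) && positive (x :: s ++ [:: y])
  = [&& x == U, y == D & motzkin true 0 s].
Proof.
apply/andP/and3P => [[/motzkinP[le tot _] /positiveP pos]|[/eqP-> /eqP-> ms]].
  have sz : size (x :: s ++ [:: y]) = (size s).+2 by rewrite /= size_cat addn1.
  rewrite sz in tot pos.
  have xU : x = U.
    have := pos 1; rewrite ups_cons downs_cons ups0 downs0 => /(_ isT).
    by case: x {le tot pos sz} => -[] [].
  rewrite xU in le tot pos.
  have last_ : downs (U :: s ++ [:: y]) (size s).+2 = downs s (size s) + y.2
    /\ ups (U :: s ++ [:: y]) (size s).+2 = (ups s (size s) + y.1).+1.
    rewrite ups_cons downs_cons -addn1 ups_catr downs_catr ups_cons downs_cons ups0 downs0.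
    by rewrite !addn0.
  have := pos (size s).+1; rewrite ltnSn ups_cons downs_cons ups_catl ?downs_catl //.
  move=> /(_ isT); rewrite [_ + ups _ _]/= => hs; rewrite (proj1 last_) (proj2 last_) in tot.
  have yD : y = D by move: tot hs; case: (y) => -[] [] //=; lia.
  split; rewrite ?xU ?yD //; rewrite yD /= in tot.
  apply/motzkinP; split=> [p||]; [|lia|by move=> *; left].
  case: (leqP p (size s)) => [ps|/ltnW ps]; last by rewrite downs_over ?ups_over //; lia.
  by have := pos p.+1; rewrite ups_cons downs_cons ups_catl ?downs_catl //= !ltnS ps => /(_ isT); lia.
split; first exact: motzkin_excursion.
have sz : size (U :: s ++ [:: D]) = (size s).+2 by rewrite /= size_cat addn1.
apply/positiveP => -[//|p]; rewrite sz => /ltnSE ps.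
rewrite ups_cons downs_cons ups_catl ?downs_catl //=.
by move/motzkinP: ms => [le _ _]; have := le p; rewrite /=; lia.
Qed.

Lemma wsum_ends N F : (forall x s y, (x, y) != (U, D) -> F (x :: s ++ [:: y]) = 0) ->
  wsum N.+2 F = wsum N (fun s => F (U :: s ++ [:: D])).
Proof.
move=> F0.
have cut x : wsum N.+1 (fun s => F (x :: s)) =
    wsum N (fun s => F (x :: s ++ [:: U]) + F (x :: s ++ [:: D]) +
      F (x :: s ++ [:: (true, true)]) + F (x :: s ++ [:: (false, false)])).
  by rewrite -addn1 wsum_cat; apply: eq_wsum => s _; rewrite wsumS /wsum !big_seq1.
rewrite wsumS !cut -!wsum_add; apply: eq_wsum => s _.
by rewrite !(F0 _ _ U) ?(F0 _ _ (true, true)) ?(F0 _ _ (false, false)) ?(F0 D)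
  ?(F0 (true, true)) ?(F0 (false, false)) // !addn0 !add0n.
Qed.

Section Avoiders.
Variables (k : nat) (q : 'S_k.+1) (m : nat) (lo hi : nat -> nat) (d : nat).
Hypothesis containsE : forall n (w : 'S_n.+1), avoids321 w ->
  heap_contains w q <-> occurs m lo hi d (word_of w).

Lemma avoidersE n (w : 'S_n.+1) :
  w \in avoiders q n <-> avoids321 w /\ avoiding m lo hi d (word_of w).
Proof.
rewrite inE; split=> [/asboolP[av nc]|[av /negP nc]].
  by split=> //; apply/negP => /asboolP /(containsE av).
by apply/asboolP; split=> // /(containsE av) c; apply: nc; apply/asboolP.
Qed.

Lemma card_avoiders n : #|avoiders q n| = motzkin_count (avoiding m lo hi d) false n.+1.
Proof. exact/card_word_set/avoidersE. Qed.

Lemma card_connected_avoiders0 : #|connected_avoiders q 0| = 0.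
Proof.
apply/eqP; rewrite cards_eq0; apply/eqP/setP => w; rewrite !inE.
by apply/negbTE/andP => -[_ /asboolP[[[]]]].
Qed.

Lemma card_connected_avoiders n :
  #|connected_avoiders q n.+1| = excursion_count (avoiding m lo hi d) n.
Proof.
rewrite (@card_word_set _ _ (fun s => avoiding m lo hi d s && positive s)); last first.
  move=> w; rewrite inE; split=> [/andP[/avoidersE[av nc] /asboolP]|[av /andP[nc pos]]].
    by move=> /(connected_word av)[_ pos]; rewrite nc.
  by apply/andP; split; [apply/avoidersE|apply/asboolP/(connected_word av)].
rewrite (eq_wsum (G := fun s => (motzkin false 0 s && positive s) && avoiding m lo hi d s)); last first.
  by move=> s _; rewrite andbAC andbA.
rewrite wsum_ends => [|x s y xy]; last first.
  by rewrite positive_motzkin; move: x y xy => [[] []] [[] []].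
by apply: eq_wsum => s _; rewrite positive_motzkin.
Qed.

End Avoiders.

(** * The diamond reduction *)

Lemma fully_supported_cells n (w : 'S_n.+1) : avoids321 w -> full_support w ->
  forall i, i < n -> lo_of w i < hi_of w i.
Proof. by move=> av full i i_n; exact: (proj1 (in_supp_cell (Ordinal i_n) av) (full _)). Qed.

Lemma internal_cells n (w : 'S_n.+1) i : avoids321 w -> full_support w ->
  two_per_internal_column w -> 0 < i -> i.+1 < n -> (lo_of w i).+2 <= hi_of w i.
Proof.
move=> av full two i0 i_n; have [u ru] := reduced_exists w.
have [k [rng inj _ _]] := avoider_cell_model av ru.
have h0 : 0 < n by lia.
have hi : i < n by lia.
have i_in : 0 < i < i.+1 by rewrite i0 ltnSn.
have := two u ru (Ordinal h0) (Ordinal i_n) (Ordinal hi) (full _) (full _) i_in.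
move=> /card_gt1P [a [b [+ + ab]]].
rewrite !inE => /eqP la /eqP lb.
have kab : k a <> k b by move=> e; case/eqP: ab; apply: inj; rewrite ?la ?lb.
by have := rng a; have := rng b; rewrite la lb /=; lia.
Qed.

Lemma last_column n (w : 'S_n.+1) : 0 < n -> hi_of w n.-1 <= (lo_of w n.-1).+1.
Proof.
move=> n0; rewrite /hi_of /lo_of prednK //.
have := rank_exc_over w (leqnn n.+1).
by have := rank_step (exc w) n; have := rank_step (excv w) n; lia.
Qed.

Section Reduction.
Variables (m : nat) (h : 'S_m.+3) (g : 'S_m.+1).
Hypotheses (m_gt0 : 0 < m) (av_h : avoids321 h) (h_full : full_support h).
Hypothesis h_columns : two_per_internal_column h.
Hypothesis g_reduction : diamond_reduction h g.

Let lo i := (lo_of h i.+1).+1.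
Let hi i := hi_of h i.+1.

Lemma reduction_nonempty i : i < m -> lo i < hi i.
Proof. by move=> im; apply: internal_cells. Qed.

Lemma reduction_staircase : staircase lo hi.
Proof. exact/diamond_staircase/staircase_of. Qed.

(** [diamond_reduction] describes the heap of one reduced expression. That heap shows that [g]
    avoids 321, so the heaps of all its reduced expressions agree. *)
Lemma reduction_model v : reduced_expr g v -> cell_model v lo hi.
Proof.
have [u [v0 [phi [[ru rv0] phi_inj phi_surj phi_label phi_ord]]]] := g_reduction.
have m0 : cell_model v0 lo hi.
  exact: (reduction_cell_model (staircase_of h) (avoider_cell_model av_h ru)
    phi_inj phi_surj phi_label phi_ord).
have av_g := cell_model_avoids321 rv0 reduction_staircase m0.
move=> rv; exact: (cell_model_transfer (avoider_cell_model av_g rv0)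
  (avoider_cell_model av_g rv) m0).
Qed.

Lemma contains_reductionE n (w : 'S_n.+1) : avoids321 w ->
  heap_contains w g <-> occurs m lo hi 0 (word_of w).
Proof.
move=> av; rewrite (heap_containsP av m_gt0 reduction_staircase reduction_nonempty reduction_model).
split=> [[j [p [r [_ occ]]]]|[a [p [r occ]]]].
  exists j.+1, p, r => i im; have := occ i im.
  by rewrite addn0 ups_word_of downs_word_of /lo_of /hi_of addSn.
have high := occurs_high m_gt0 reduction_nonempty occ.
have a0 : 0 < a.
  by have := high 0 m_gt0; rewrite ups_word_of downs_word_of; case: (a) => //; rewrite !rank0.
exists a.-1, p, r; split.
  rewrite leqNgt; apply/negP => lt; have m1 : m.-1 < m by rewrite prednK.
  have := high _ m1; rewrite ups_word_of downs_word_of rank_exc_over //; lia.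
move=> i im; have := occ i im; rewrite addn0 ups_word_of downs_word_of /lo_of /hi_of.
by rewrite -addSn prednK.
Qed.

(** Only the internal columns of [h] are compared by [occurs]. Each outer column is a single cell
    next to a column with at least two, which fixes its boundaries, and its inequalities follow from
    those of its neighbor. *)
Lemma containsE n (w : 'S_n.+1) : avoids321 w ->
  heap_contains w h <-> occurs m lo hi 1 (word_of w).
Proof.
move=> av; have st := staircase_of h.
rewrite (heap_containsP av (ltn0Sn _) st (fully_supported_cells av_h h_full)
  (fun v => avoider_cell_model av_h (u := v))).
have [sl sh h0] := st.
split=> [[j [p [r [_ occ]]]]|[a [p [r occ]]]].
  exists j.+2, p, r => i im; have := occ i.+1 (leqW im : i.+1 < m.+2).
  by rewrite ups_word_of downs_word_of /lo /hi /lo_of /hi_of addnS !addSn; lia.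
have high := occurs_high m_gt0 reduction_nonempty occ.
have V := fun i => rank_step (excv w) i; have E := fun i => rank_step (exc w) i.
(* The height at [a] is at least 2, so there is room on the left for the first column of [h]. *)
have a2 : 1 < a.
  have := high 0 m_gt0; rewrite addn0 ups_word_of downs_word_of.
  by case: (a) => [|[|//]]; [rewrite !rank0|have := E 0; rewrite rank0; lia].
have m1 : m.-1 < m by rewrite prednK.
exists a.-2, p, r; split.
  rewrite leqNgt; apply/negP => lt; have := high _ m1; rewrite ups_word_of downs_word_of.
  have : n <= a + m.-1 by lia.
  rewrite leq_eqVlt => /orP[/eqP <-|/(rank_exc_over w) -> ]; last by lia.
  by have := rank_exc_over w (leqnn n.+1); have := V n; have := E n; lia.
have occ' i : i < m -> rank (excv w) (a + i) + r <= lo_of h i.+1 + p /\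
    hi_of h i.+1 + p <= rank (exc w) (a + i) + r.
  by move=> im; have := occ i im; rewrite ups_word_of downs_word_of /lo /hi; lia.
move=> i im.
suff : rank (excv w) (a.-1 + i) + r <= lo_of h i + p /\
    hi_of h i + p <= rank (exc w) (a.-1 + i) + r.
  by rewrite [lo_of w _]/lo_of [hi_of w _]/hi_of -!addSn (_ : a.-2.+1 = a.-1) //; lia.
case: i im => [_|i].
  (* From column 0 to column 1, [hi_of h] must rise and [lo_of h] stay; at the other end of [h],
     treated last, [lo_of h] must rise and [hi_of h] stay. *)
  have := occ' 0 m_gt0; have := internal_cells av_h h_full h_columns (ltn0Sn 0) m_gt0.
  have := V a.-1; have := E a.-1; rewrite prednK; last lia.
  by have := sl 0; have := sh 0; rewrite !addn0; lia.
rewrite ltnS ltnS leq_eqVlt => /orP[/eqP ->|im]; last first.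
  by have := occ' i im; rewrite addnS -addSn prednK //; lia.
have := occ' _ m1; have := internal_cells av_h h_full h_columns m_gt0 (leqnn m.+2).
have := last_column h (ltn0Sn _); rewrite /= prednK //.
have := V (a + m.-1); have := E (a + m.-1); rewrite -addnS prednK //.
rewrite (_ : a.-1 + m.+1 = a + m); last lia.
by have := sl m; have := sh m; lia.
Qed.

End Reduction.

(** * Generating functions *)

Local Open Scope ring_scope.

Lemma fps_mulE (s t : fps) n : (s * t) n = \sum_(i < n.+1) s i * t (n - i)%N.
Proof. by []. Qed.

Lemma fps_addE (s t : fps) n : (s + t) n = s n + t n.
Proof. by []. Qed.

Lemma fps_oneE n : (1 : fps) n = (n == 0%N)%:R.
Proof. by []. Qed.

Lemma fps_mul_coef0 (s t : fps) : (s * t) 0%N = s 0%N * t 0%N.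
Proof. by rewrite fps_mulE big_ord1. Qed.

Lemma fpsX_coef0 (s : fps) : (fpsX * s) 0%N = 0.
Proof. by rewrite fps_mul_coef0 mul0r. Qed.

Lemma fpsX_coefS (s : fps) n : (fpsX * s) n.+1 = s n.
Proof.
rewrite fps_mulE big_ord_recl mul0r add0r big_ord_recl mul1r subSS subn0.
by rewrite big1 ?addr0 // => i _; rewrite mul0r.
Qed.

Lemma fpsX_inj : injective ( *%R fpsX).
Proof.
move=> s t e; apply/funext => n.
have := congr1 (fun r : fps => r n.+1) e; rewrite (fpsX_coefS s) (fpsX_coefS t).
exact.
Qed.

Lemma fps_mulrn_coef (s : fps) k n : (s *+ k) n = s n *+ k.
Proof. by elim: k => // k IHk; rewrite !mulrS fps_addE IHk. Qed.

Lemma gen_fun_rec (a c : nat -> nat) k : a 0%N = 1%N ->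
    (forall n, a n.+1 = (k * a n + \sum_(i < n) c i * a (n - i.+1))%N) ->
  gen_fun a = 1 + k%:R * (fpsX * gen_fun a) + fpsX * (fpsX * (gen_fun c * gen_fun a)).
Proof.
move=> a0 arec; apply/funext => n; rewrite !fps_addE fps_oneE mulr_natl fps_mulrn_coef.
case: n => [|n].
  by rewrite !fpsX_coef0 mul0rn !addr0 /gen_fun a0.
rewrite !fpsX_coefS {1}/gen_fun arec natrD natrM mulr_natl add0r; congr (_ + _).
case: n => [|n]; first by rewrite big_ord0 fpsX_coef0.
rewrite fpsX_coefS fps_mulE natr_sum; apply: eq_bigr => i _.
by rewrite natrM subSS.
Qed.

Lemma unit_fpsE (s : fps) : (s \is a GRing.unit) = (s 0%N != 0).
Proof. by []. Qed.

Section MainIdentity.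
Variables a A f c G F : fps.
Let x := fpsX.
Hypothesis aE : a = 1 + 1 * (x * a) + x * (x * (c * a)).
Hypothesis AE : A = 1 + 2%:R * (x * A) + x * (x * (c * A)).
Hypothesis fE : f = 1 + 1 * (x * f) + x * (x * (A * f)).
Hypothesis aG : a = 1 + x * G.
Hypothesis fF : f = 1 + x * F.

Let den : fps := 1 - 3%:R * x + x ^+ 2 + (x ^+ 2 - x) * (x * c).
Let num : fps := 1 - x - x * (x * c).

Lemma coef0_den : den 0%N = 1.
Proof.
have -> : den = 1 + x * (- 3%:R + x + (x - 1) * (x * c)) by rewrite /den; ring.
by rewrite fps_addE fpsX_coef0 addr0.
Qed.

Lemma coef0_num : num 0%N = 1.
Proof.
have -> : num = 1 + x * (- 1 - x * c) by rewrite /num; ring.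
by rewrite fps_addE fpsX_coef0 addr0.
Qed.

Lemma coef0_den' : (1 - 2%:R * x - x ^+ 2 * G) 0%N = 1.
Proof.
have -> : 1 - 2%:R * x - x ^+ 2 * G = 1 + x * (- 2%:R - x * G) by ring.
by rewrite fps_addE fpsX_coef0 addr0.
Qed.

(** With [A = 1 / u] and [f = 1 / (1 - x - x^2 A)] one gets [f = u / den], where
    [den = (1 - x) u - x^2]. Then [x F = f - 1] and [u - den = x num]. *)
Lemma quotient_identity : F * den = num.
Proof.
apply: fpsX_inj; rewrite -/x.
pose u := 1 - 2%:R * x - x * (x * c).
have uA : u * A = 1.
  rewrite (_ : u * A = 1 + (A - (1 + 2%:R * (x * A) + x * (x * (c * A))))).
    by rewrite -AE subrr addr0.
  by rewrite /u; ring.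
have fA : f * (1 - x - x * (x * A)) = 1.
  rewrite (_ : f * _ = 1 + (f - (1 + 1 * (x * f) + x * (x * (A * f))))); last by ring.
  by rewrite -fE subrr addr0.
have fden : f * den = u.
  rewrite (_ : f * den = f * (1 - x - x * (x * A)) * u + f * (x * x) * (u * A - 1)).
    by rewrite fA uA; ring.
  by rewrite /den /u; ring.
rewrite (_ : x * (F * den) = (1 + x * F) * den - den); last by ring.
by rewrite -fF fden /den /num /u; ring.
Qed.

(** [num] is the inverse of [a = 1 + x G], and multiplying the second denominator by [num] gives
    [den]. *)
Lemma inverse_identity : F * (1 - 2%:R * x - x ^+ 2 * G) = 1.
Proof.
have ra : num * (1 + x * G) = 1.
  rewrite -aG (_ : num * a = 1 + (a - (1 + 1 * (x * a) + x * (x * (c * a))))).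
    by rewrite -aE subrr addr0.
  by rewrite /num; ring.
have e : num * (1 - 2%:R * x - x ^+ 2 * G) = den.
  rewrite (_ : num * _ = num * (1 - x) - x * (num * (1 + x * G))); last by ring.
  by rewrite ra /num /den; ring.
have ur : num \is a GRing.unit by rewrite unit_fpsE coef0_num oner_eq0.
by apply: (mulrI ur); rewrite mulrCA e quotient_identity mulr1.
Qed.

End MainIdentity.

Theorem theorem3p6 (m : nat) (h : 'S_m.+3) (g : 'S_m.+1)
    (h_connected : connected h) (h_full : full_support h)
    (h_fc : fully_commutative h) (h_columns : two_per_internal_column h)
    (g_reduction : diamond_reduction h g) :
  let x := fpsX in
  let G := gen_fun (fun n => #|avoiders g n|) in
  let Gc := gen_fun (fun n => #|connected_avoiders g n|) in
  let F := gen_fun (fun n => #|avoiders h n|) in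
  G 0%N = 1 ->
  [/\ Gc 0%N = 0, F 0%N = 1,
      1 - 3%:R * x + x ^+ 2 + (x ^+ 2 - x) * Gc \is a GRing.unit
      /\ 1 - 2%:R * x - x ^+ 2 * G \is a GRing.unit,
      F = (1 - x - x * Gc) / (1 - 3%:R * x + x ^+ 2 + (x ^+ 2 - x) * Gc)
    & F = 1 / (1 - 2%:R * x - x ^+ 2 * G)].
Proof.
move=> x G Gc F G0.
(* For [m = 0] the heap of [g] is empty, hence contained in every heap; nothing would avoid [g],
   contrary to [G 0 = 1]. *)
have m_gt0 : (0 < m)%N.
  rewrite lt0n; apply/eqP => m0; move: G0; rewrite /G /gen_fun.
  suff -> : avoiders g 0 = finset.set0 by rewrite cards0 => /eqP; rewrite eq_sym oner_eq0.
  apply/setP => w; rewrite !inE; apply/negbTE/asboolP => -[_]; apply.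
  have [u ru] := reduced_exists w; have [v rv] := reduced_exists g.
  have no (i : 'I_m) : False by have := ltn_ord i; lia.
  have no0 (i : 'I_0) : False by case: i.
  have vnil : v = [::] by case: v rv => // i; case: (no i).
  exists u, v, (fun i => match no i with end); split=> //.
    by split=> [i|? _ i|i]; case: (no i).
  by rewrite vnil; exists (fun a : 'I_0 => match no0 a with end); split=> a; case: (no0 a).
have av_h := fully_commutative_avoids321 h_fc.
pose lo i := (lo_of h i.+1).+1; pose hi i := hi_of h i.+1.
have ne : forall i, (i < m)%N -> (lo i < hi i)%N := reduction_nonempty av_h h_full h_columns.
pose X d := avoiding m lo hi d.
have Xl d e s : X d ((e, e) :: s) = X d s := avoiding_level m_gt0 ne d e s.
have Xe d s t : motzkin true 0 s -> X d (U :: s ++ D :: t) = X d (U :: s ++ [:: D]) && X d t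
  := avoiding_excursion m_gt0 ne d t.
pose a n := motzkin_count (X 0%N) false n; pose A n := motzkin_count (X 0%N) true n.
pose f n := motzkin_count (X 1%N) false n; pose c n := excursion_count (X 0%N) n.
have gE n (w : 'S_n.+1) : avoids321 w -> heap_contains w g <-> occurs m lo hi 0 (word_of w)
  := contains_reductionE m_gt0 av_h h_full h_columns g_reduction (w := w).
have hE n (w : 'S_n.+1) : avoids321 w -> heap_contains w h <-> occurs m lo hi 1 (word_of w)
  := containsE m_gt0 av_h h_full h_columns (w := w).
have one d z : motzkin_count (X d) z 0 = 1%N.
  by rewrite /motzkin_count /wsum big_seq1 /= /X (avoiding_nil m_gt0 ne).
have Ac n : excursion_count (X 1%N) n = A n.
  apply: eq_wsum => s _; case ms: (motzkin true 0 s) => //=.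
  by rewrite /X (avoiding_reduce m_gt0 ne).
have aE := gen_fun_rec (k := 1) (one 0%N false) (motzkin_count_rec (Xl 0%N) (Xe 0%N) false).
have AE := gen_fun_rec (k := 2) (one 0%N true) (motzkin_count_rec (Xl 0%N) (Xe 0%N) true).
have fE := gen_fun_rec (k := 1) (one 1%N false) (motzkin_count_rec (Xl 1%N) (Xe 1%N) false).
rewrite -/a -/A -/f -/c in aE AE fE.
have AcE : gen_fun (excursion_count (X 1%N)) = gen_fun A.
  by apply/funext => n; rewrite /gen_fun Ac.
rewrite AcE in fE.
(* Permutations in ['S_n.+1] correspond to words of length [n.+1]; the extra constant term 1 counts
   the empty word. *)
have shiftE (b b' : nat -> nat) : b 0%N = 1%N -> (forall n, b' n = b n.+1) ->
    gen_fun b = 1 + fpsX * gen_fun b'.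
  move=> b0 bS; apply/funext => -[|n]; rewrite fps_addE fps_oneE.
    by rewrite fpsX_coef0 addr0 /gen_fun b0.
  by rewrite fpsX_coefS add0r /gen_fun bS.
have aG : gen_fun a = 1 + x * G := shiftE _ _ (one _ _) (card_avoiders gE).
have fF : gen_fun f = 1 + x * F := shiftE _ _ (one _ _) (card_avoiders hE).
have GcE : Gc = x * gen_fun c.
  apply/funext => -[|n]; first by rewrite fpsX_coef0 /Gc /gen_fun card_connected_avoiders0.
  by rewrite fpsX_coefS /Gc /gen_fun (card_connected_avoiders gE).
have F0 : F 0%N = 1.
  by rewrite /F /gen_fun (card_avoiders hE) (motzkin_count_rec (Xl 1%N) (Xe 1%N)) big_ord0 one.
have unit1 : 1 - 3%:R * x + x ^+ 2 + (x ^+ 2 - x) * Gc \is a GRing.unit.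
  by rewrite unit_fpsE GcE coef0_den oner_eq0.
have unit2 : 1 - 2%:R * x - x ^+ 2 * G \is a GRing.unit.
  by rewrite unit_fpsE coef0_den' oner_eq0.
split=> //; first by rewrite GcE fpsX_coef0.
  apply: (canRL (mulrK unit1)); rewrite GcE.
  exact: (quotient_identity AE fE fF).
apply: (canRL (mulrK unit2)).
exact: (inverse_identity aE AE fE aG fF).
Qed.
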